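(* Let $R$ be a Prüfer ring such that $R$ has the $1\frac12$ generator property and $R$ has small zero-divisors. Let $\mathcal C_{\mathrm{proj}}$ be the class of finitely generated projective $R$-modules. 1. $\mathcal V(\mathcal C_{\mathrm{proj}})$ is a finitely primary monoid of rank $1$ and of exponent $1$. Moreover, $\mathcal V(\mathcal C_{\mathrm{proj}})$ is finitely generated if and only if $\mathrm{Pic}(R)$ is finite. 2. If $\mathcal C_{\mathrm{proj}}$ does not satisfy KRSA, then $\mathcal V(\mathcal C_{\mathrm{proj}})$ is half-factorial with $\mathsf c\big(\mathcal V(\mathcal C_{\mathrm{proj}})\big)=\mathsf t\big(\mathcal V(\mathcal C_{\mathrm{proj}})\big)=2$.
   Context: Rings: A Prüfer ring is a commutative ring (possibly with zero-divisors) in which every finitely generated regular ideal (an ideal containing a non-zero-divisor) is invertible. A commutative ring $R$ has the $1\frac12$ generator property if, for any invertible ideal $I\subset R$ and any regular element $a\in I\setminus\mathrm{rad}(R)I$ ($\mathrm{rad}(R)$ the Jacobson radical), there exists $b\in R$ with $I=Ra+Rb$. $R$ has small zero-divisors if for every zero-divisor $a\in R$ and any ideal $A\subset R$, $A+aR=R$ implies $A=R$. $\mathrm{Pic}(R)$ is the Picard group. Monoid of modules: for a class $\mathcal C$ of modules (with a set of isomorphism classes) closed under finite direct sums, direct summands and isomorphisms, $\mathcal V(\mathcal C)$ is the set of isomorphism classes $[M]$ with operation $[M]+[N]=[M\oplus N]$. KRSA (Krull–Remak–Schmidt–Azumaya) holds for $\mathcal C$ if direct-sum decompositions into indecomposables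 are unique up to order and isomorphism, equivalently $\mathcal V(\mathcal C)$ is a free abelian monoid. Monoid: commutative cancellative semigroup with identity. A monoid $H$ is finitely primary of rank $s$ and exponent $\alpha$ ($s,\alpha\in\mathbb N$) if $H$ is a submonoid of a factorial monoid $F=F^\times\times[p_1,\ldots,p_s]$ with $s$ pairwise non-associated prime elements $p_1,\ldots,p_s$ such that $H\setminus H^\times\subset p_1\cdots p_sF$ and $(p_1\cdots p_s)^\alpha F\subset H$. Factorizations: $H_{\mathrm{red}}=\{aH^\times:a\in H\}$; $\mathsf Z(a)$ is the set of factorizations of $aH^\times$ into atoms of $H_{\mathrm{red}}$ (formal products, up to order); $|z|$ is the number of factors of $z$; $\mathsf L(a)=\{|z|:z\in\mathsf Z(a)\}$. $H$ is half-factorial if it is atomic and $|\mathsf L(a)|=1$ for all $a$. $\mathsf d(z,z')=\max\{|z\gcd(z,z')^{-1}|,|z'\gcd(z,z')^{-1}|\}$. $\mathsf c(a)$ is the smallest $N\in\mathbb N_0\cup\{\infty\}$ such that any $z,z'\in\mathsf Z(a)$ can be joined by a finite chain in $\mathsf Z(a)$ with consecutive distances $\le N$; $\mathsf c(H)=\sup_a\mathsf c(a)$. For an atom $u\in H_{\mathrm{red}}$, $\mathsf t(H,u)$ is the smallest $N\in\mathbb N_0\cup\{\infty\}$ such that for every multiple $a\in H_{\mathrm{red}}$ of $u$ and every factorization $v_1\cdots v_n\in\mathsf Z(a)$ not containing $u$, there is (after renumbering) a subproduct $v_1\cdots v_m$ that is a multiple of $u$ and a refactorization $v_1\cdots v_m=uu_2\cdots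 u_\ell$ into atoms with $\max\{\ell,m\}\le N$; $\mathsf t(H)=\sup_u\mathsf t(H,u)$. *)

(* Defs.v *)
From HB Require Import structures.
From mathcomp Require Import all_boot all_algebra finmap multiset.
From mathcomp Require Import ring.
From mathcomp Require Import boolp classical_sets functions cardinality.

Set Implicit Arguments.
Unset Strict Implicit.
Unset Printing Implicit Defensive.

Import GRing.Theory.
Local Open Scope ring_scope.
Local Open Scope quotient_scope.
Local Open Scope classical_set_scope.

(* Over a commutative ring, [GRing.lreg x] says that x is a non-zero-divisor. *)
Definition zero_divisor (R : comNzRingType) (a : R) : Prop :=
  exists2 b : R, b != 0 & a * b = 0.

(* Fractions a / s with s regular, following mathcomp's [fraction.v], which
   only treats integral domains. *)
Module TotalQuotient.
Section TotalQuotient.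
Variable R : comNzRingType.

Record ratio := Ratio { num : R; den : R; denP : GRing.lreg den }.
Arguments denP : clear implicits.

#[export]
HB.instance Definition _ := gen_eqMixin ratio.
#[export]
HB.instance Definition _ := gen_choiceMixin ratio.

Implicit Types x y z : ratio.

Definition equivr x y : bool := num x * den y == num y * den x.

Lemma equivr_refl : reflexive equivr.
Proof. by move=> x; rewrite /equivr. Qed.

Lemma equivr_sym : symmetric equivr.
Proof. by move=> x y; rewrite /equivr eq_sym. Qed.

Lemma equivr_trans : transitive equivr.
Proof.
move=> y x z /eqP xy /eqP yz; apply/eqP; apply: (denP y).
by rewrite mulrA [den y * _]mulrC xy mulrAC yz; ring.
Qed.

Canonical equivr_equiv := EquivRel equivr equivr_refl equivr_sym equivr_trans.

Definition type := {eq_quot equivr}.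
#[export]
HB.instance Definition _ : EqQuotient _ equivr type := EqQuotient.on type.
#[export]
HB.instance Definition _ := Choice.on type.

Lemma equivr_repr x : num (repr (\pi_type x)) * den x = num x * den (repr (\pi_type x)).
Proof.
by apply/eqP; have /eqP := reprK (\pi_type x); rewrite eqmodE.
Qed.

Definition ofR (a : R) : type := \pi_type (Ratio a (@GRing.lreg1 R)).

Definition addr x y : ratio :=
  Ratio (num x * den y + num y * den x) (GRing.lregM (denP x) (denP y)).
Definition oppr x : ratio := Ratio (- num x) (denP x).
Definition mulr x y : ratio :=
  Ratio (num x * num y) (GRing.lregM (denP x) (denP y)).

Definition add := lift_op2 type addr.
Definition opp := lift_op1 type oppr.
Definition mul := lift_op2 type mulr.

Lemma pi_add : {morph \pi : x y / addr x y >-> add x y}.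
Proof.
move=> x y; unlock add; apply/eqmodP; rewrite /= /equivr /=.
set x' := repr _; set y' := repr _; apply/eqP.
have ex : num x' * den x = num x * den x' := equivr_repr x.
have ey : num y' * den y = num y * den y' := equivr_repr y.
transitivity ((num x * den x') * den y * den y' + (num y * den y') * den x * den x').
  by ring.
by rewrite -ex -ey; ring.
Qed.
Canonical pi_add_morph := PiMorph2 pi_add.

Lemma pi_opp : {morph \pi : x / oppr x >-> opp x}.
Proof.
move=> x; unlock opp; apply/eqmodP; rewrite /= /equivr /=.
by rewrite !mulNr equivr_repr.
Qed.
Canonical pi_opp_morph := PiMorph1 pi_opp.

Lemma pi_mul : {morph \pi : x y / mulr x y >-> mul x y}.
Proof.
move=> x y; unlock mul; apply/eqmodP; rewrite /= /equivr /=.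
by rewrite mulrACA -!equivr_repr mulrACA.
Qed.
Canonical pi_mul_morph := PiMorph2 pi_mul.

Lemma ratio_eq x y : num x = num y -> den x = den y -> x = y.
Proof.
case: x y => [a s sP] [b t tP] /= eab est; subst b t.
by congr Ratio; exact: Prop_irrelevance.
Qed.

Lemma addA : associative add.
Proof.
elim/quotW=> x; elim/quotW=> y; elim/quotW=> z; rewrite !piE.
by congr \pi; apply: ratio_eq => /=; ring.
Qed.

Lemma addC : commutative add.
Proof.
elim/quotW=> x; elim/quotW=> y; rewrite !piE.
by congr \pi; apply: ratio_eq; rewrite /= 1?addrC 1?mulrC.
Qed.

Lemma add0 : left_id (ofR 0) add.
Proof.
elim/quotW=> x; rewrite /ofR !piE.
by congr \pi; apply: ratio_eq; rewrite /= ?mul0r ?add0r ?mulr1 ?mul1r.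
Qed.

Lemma addN : left_inverse (ofR 0) opp add.
Proof.
elim/quotW=> x; rewrite /ofR !piE; apply/eqmodP.
by rewrite /= /equivr /= mulNr addNr !mul0r.
Qed.

#[export]
HB.instance Definition _ := GRing.isZmodule.Build type addA addC add0 addN.

Lemma mulA : associative mul.
Proof.
elim/quotW=> x; elim/quotW=> y; elim/quotW=> z; rewrite !piE.
by congr \pi; apply: ratio_eq; rewrite /= mulrA.
Qed.

Lemma mulC : commutative mul.
Proof.
elim/quotW=> x; elim/quotW=> y; rewrite !piE.
by congr \pi; apply: ratio_eq; rewrite /= mulrC.
Qed.

Lemma mul1 : left_id (ofR 1) mul.
Proof.
elim/quotW=> x; rewrite /ofR !piE.
by congr \pi; apply: ratio_eq; rewrite /= mul1r.
Qed.

Lemma mulDl : left_distributive mul add.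
Proof.
elim/quotW=> x; elim/quotW=> y; elim/quotW=> z; rewrite !piE; apply/eqmodP.
by apply/eqP => /=; ring.
Qed.

Lemma nz1 : ofR 1 != ofR 0.
Proof.
by apply/eqP => /eqP; rewrite /ofR eqmodE /= /equivr /= mulr1 mul0r oner_eq0.
Qed.

#[export]
HB.instance Definition _ :=
  GRing.Zmodule_isComNzRing.Build type mulA mulC mul1 mulDl nz1.

Lemma ofR_is_zmod_morphism : zmod_morphism ofR.
Proof.
move=> a b; rewrite /ofR -[X in _ = _ + X]pi_opp -[RHS]pi_add.
by congr \pi; apply: ratio_eq; rewrite /= !mulr1.
Qed.

Lemma ofR_is_monoid_morphism : monoid_morphism ofR.
Proof.
split=> [//|a b]; rewrite /ofR -[RHS]pi_mul.
by congr \pi; apply: ratio_eq; rewrite /= ?mulr1.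
Qed.

#[export]
HB.instance Definition _ :=
  GRing.isZmodMorphism.Build R type ofR ofR_is_zmod_morphism.
#[export]
HB.instance Definition _ :=
  GRing.isMonoidMorphism.Build R type ofR ofR_is_monoid_morphism.

End TotalQuotient.
Module Exports. HB.reexport. End Exports.
End TotalQuotient.
Export TotalQuotient.Exports.

Notation total_quotient := TotalQuotient.type.
Notation "x %:Q0" := (TotalQuotient.ofR x) (at level 2, left associativity).

Section Ideals.
Variable R : comNzRingType.
Implicit Types (I J : set R) (a x : R).

Definition ideal I : Prop :=
  [/\ I 0, forall x y, I x -> I y -> I (x + y) & forall a x, I x -> I (a * x)].

Definition fin_gen_ideal I : Prop :=
  exists n (g : 'I_n -> R),
    I = [set x | exists c : 'I_n -> R, x = \sum_i c i * g i].

Definition regular_ideal I : Prop := exists2 a, I a & GRing.lreg a.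

Definition maximal_ideal I : Prop :=
  [/\ ideal I, I <> setT &
      forall J, ideal J -> I `<=` J -> J = I \/ J = setT].

Definition jacobson_radical : set R :=
  [set x | forall I, maximal_ideal I -> I x].

Definition ideal_add I J : set R := [set x | exists y z, [/\ I y, J z & x = y + z]].

Definition principal a : set R := [set x | exists c, x = c * a].

Definition ideal_inv I : set (total_quotient R) :=
  [set q | forall x, I x -> exists y, q * x%:Q0 = y%:Q0].

End Ideals.
Arguments jacobson_radical : clear implicits.

(* Products of additive subgroups; for ideals of R, and for I * I^-1 in Q(R). *)
Definition set_prod (A : pzRingType) (I J : set A) : set A :=
  [set x | exists n (a b : 'I_n -> A),
     [/\ forall i, I (a i), forall i, J (b i) & x = \sum_i a i * b i]].

Definition invertible_ideal (R : comNzRingType) (I : set R) : Prop :=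
  ideal I /\
  set_prod [set x%:Q0 | x in I] (ideal_inv I) = [set x%:Q0 | x in [set: R]].

Definition prufer_ring (R : comNzRingType) : Prop :=
  forall I : set R, ideal I -> fin_gen_ideal I -> regular_ideal I ->
    invertible_ideal I.

Definition one_half_generator (R : comNzRingType) : Prop :=
  forall (I : set R) (a : R), invertible_ideal I -> GRing.lreg a ->
    I a -> ~ set_prod (jacobson_radical R) I a ->
    exists b : R, I = ideal_add (principal a) (principal b).

Definition small_zero_divisors (R : comNzRingType) : Prop :=
  forall (a : R) (A : set R), zero_divisor a -> ideal A ->
    ideal_add A (principal a) = [set: R] -> A = [set: R].

Section Modules.
Variable R : comNzRingType.
Implicit Types M N P : lmodType R.

Definition mod_iso M N : Prop := exists f : {linear M -> N}, bijective f.

Definition zero_module : lmodType R := 'rV[R]_0.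

Definition dsum M N : lmodType R := (M * N)%type.

Definition fin_gen M : Prop :=
  exists n (g : 'I_n -> M),
    forall x : M, exists c : 'I_n -> R, x = \sum_i c i *: g i.

Definition projective P : Prop :=
  forall (M N : lmodType R) (p : {linear M -> N}) (f : {linear P -> N}),
    (forall y : N, exists x : M, p x = y) ->
    exists h : {linear P -> M}, forall x : P, p (h x) = f x.

Definition indecomposable M : Prop :=
  ~ mod_iso M zero_module /\
  forall A B : lmodType R, mod_iso M (dsum A B) ->
    mod_iso A zero_module \/ mod_iso B zero_module.

Fixpoint dsums n : ('I_n -> lmodType R) -> lmodType R :=
  match n with
  | 0 => fun=> zero_module
  | n'.+1 => fun M : 'I_n'.+1 -> lmodType R =>
      dsum (M ord0) (dsums (fun i => M (lift ord0 i)))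
  end.

Lemma mod_iso_refl M : mod_iso M M.
Proof. by exists idfun; exists idfun. Qed.

Lemma mod_iso_sym M N : mod_iso M N -> mod_iso N M.
Proof.
move=> [f [g fg gf]].
have gl : linear g.
  by move=> a x y; apply: (can_inj fg); rewrite gf linearP !gf.
pose gL := HB.pack_for {linear N -> M} g (GRing.isLinear.Build R N M _ g gl).
by exists gL; exists f.
Qed.

Lemma mod_iso_trans N M P : mod_iso M N -> mod_iso N P -> mod_iso M P.
Proof. by move=> [f bf] [g bg]; exists (g \o f); exact: bij_comp. Qed.

Lemma mod_iso_dsum M M' N N' :
  mod_iso M M' -> mod_iso N N' -> mod_iso (dsum M N) (dsum M' N').
Proof.
move=> [f [f' ff' f'f]] [g [g' gg' g'g]].
pose h (x : dsum M N) : dsum M' N' := (f x.1, g x.2).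
have hl : linear h by move=> a x y; rewrite /h /= !linearP.
pose hL := HB.pack_for {linear dsum M N -> dsum M' N'} h
  (GRing.isLinear.Build R _ _ _ h hl).
exists hL; exists (fun x => (f' x.1, g' x.2)).
  by case=> x y; rewrite /= /h /= ff' gg'.
by case=> x y; rewrite /= /h /= f'f g'g.
Qed.

Lemma dsum_isoA M N P : mod_iso (dsum M (dsum N P)) (dsum (dsum M N) P).
Proof.
pose h (x : dsum M (dsum N P)) : dsum (dsum M N) P := ((x.1, x.2.1), x.2.2).
have hl : linear h by move=> a x y.
pose hL := HB.pack_for {linear dsum M (dsum N P) -> dsum (dsum M N) P} h
  (GRing.isLinear.Build R _ _ _ h hl).
by exists hL; exists (fun x => (x.1.1, (x.1.2, x.2))) => [] [] => [? []|[]].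
Qed.

Lemma dsum_isoC M N : mod_iso (dsum M N) (dsum N M).
Proof.
pose h (x : dsum M N) : dsum N M := (x.2, x.1).
have hl : linear h by move=> a x y.
pose hL := HB.pack_for {linear dsum M N -> dsum N M} h
  (GRing.isLinear.Build R _ _ _ h hl).
by exists hL; exists (fun x => (x.2, x.1)) => - [].
Qed.

Lemma dsum_iso0 M : mod_iso (dsum zero_module M) M.
Proof.
pose h (x : dsum zero_module M) : M := x.2.
have hl : linear h by move=> a x y.
pose hL := HB.pack_for {linear dsum zero_module M -> M} h
  (GRing.isLinear.Build R _ _ _ h hl).
exists hL; exists (fun x => (0, x)) => // - [z x] /=.
by congr pair; apply/matrixP => i [].
Qed.

End Modules.

Section IsoClasses.
Variable R : comNzRingType.
Implicit Types M N : lmodType R.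

(* The class of all R-modules is too large to be quotiented inside a
   [choiceType]; [reps] witnesses that C has only a set of isomorphism classes.
   [iso_classP] and [iso_class_surj] below show that the quotient does not
   depend on this choice. *)
Record small_class := SmallClass {
  in_class :> lmodType R -> Prop;
  reps : choiceType;
  rep : reps -> lmodType R;
  repP : forall i, in_class (rep i);
  rep_surj : forall M, in_class M -> exists i, mod_iso M (rep i) }.

Section Quotient.
Variable C : small_class.

Definition rep_iso (i j : reps C) : bool := `[< mod_iso (rep i) (rep j) >].

Lemma rep_iso_refl : reflexive rep_iso.
Proof. by move=> i; apply/asboolP; exact: mod_iso_refl. Qed.

Lemma rep_iso_sym : symmetric rep_iso.
Proof. by move=> i j; apply/asboolP/asboolP; exact: mod_iso_sym. Qed.

Lemma rep_iso_trans : transitive rep_iso.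
Proof.
by move=> j i k /asboolP ij /asboolP jk; apply/asboolP; exact: mod_iso_trans jk.
Qed.

Canonical rep_iso_equiv :=
  EquivRel rep_iso rep_iso_refl rep_iso_sym rep_iso_trans.

Definition iso_classes := {eq_quot rep_iso}.
HB.instance Definition _ : EqQuotient _ rep_iso iso_classes :=
  EqQuotient.on iso_classes.
HB.instance Definition _ := Choice.on iso_classes.

Definition iso_class M (CM : C M) : iso_classes :=
  \pi_iso_classes (sval (cid (rep_surj CM))).

Lemma iso_classP M N (CM : C M) (CN : C N) :
  iso_class CM = iso_class CN <-> mod_iso M N.
Proof.
rewrite /iso_class; case: cid => i /= Mi; case: cid => j /= Nj; split.
  move/eqP; rewrite eqmodE => /asboolP ij.
  by apply: mod_iso_trans Mi _; apply: mod_iso_trans ij _; exact: mod_iso_sym.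
move=> MN; apply/eqP; rewrite eqmodE; apply/asboolP.
by apply: mod_iso_trans Nj; apply: mod_iso_trans MN; exact: mod_iso_sym.
Qed.

Definition class_rep (x : iso_classes) : lmodType R := rep (repr x).

Lemma class_repP x : C (class_rep x).
Proof. exact: repP. Qed.

Lemma iso_class_rep x : iso_class (class_repP x) = x.
Proof.
rewrite -[RHS]reprK /iso_class; case: cid => i /= ri; apply/eqP.
by rewrite eqmodE; apply/asboolP; exact: mod_iso_sym.
Qed.

Lemma iso_class_surj x : exists M (CM : C M), x = iso_class CM.
Proof. by exists (class_rep x), (class_repP x); rewrite iso_class_rep. Qed.

End Quotient.

Record module_class := ModuleClass {
  class_small :> small_class;
  class_iso : forall M N, mod_iso M N -> class_small M -> class_small N;
  class_zero : class_small (zero_module R);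
  class_dsum : forall M N,
    class_small M -> class_small N -> class_small (dsum M N);
  class_summand : forall M N, class_small (dsum M N) -> class_small M }.

Section Monoid.
Variable C : module_class.

Definition class_monoid := iso_classes C.
HB.instance Definition _ := Choice.on class_monoid.

Definition cm_zero : class_monoid := iso_class (class_zero C).
Definition cm_add (x y : class_monoid) : class_monoid :=
  iso_class (class_dsum (class_repP x) (class_repP y)).

Lemma cm_add_class M N (CM : C M) (CN : C N) :
  cm_add (iso_class CM) (iso_class CN) = iso_class (class_dsum CM CN).
Proof.
apply/iso_classP; apply: mod_iso_dsum.
  by apply/(iso_classP (class_repP _) CM); rewrite iso_class_rep.
by apply/(iso_classP (class_repP _) CN); rewrite iso_class_rep.
Qed.

Lemma cm_addA : associative cm_add.
Proof.
move=> x y z; have [M [CM ->]] := iso_class_surj x.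
have [N [CN ->]] := iso_class_surj y; have [P [CP ->]] := iso_class_surj z.
by rewrite !cm_add_class; apply/iso_classP; exact: dsum_isoA.
Qed.

Lemma cm_addC : commutative cm_add.
Proof.
move=> x y; have [M [CM ->]] := iso_class_surj x.
have [N [CN ->]] := iso_class_surj y.
by rewrite !cm_add_class; apply/iso_classP; exact: dsum_isoC.
Qed.

Lemma cm_add0 : left_id cm_zero cm_add.
Proof.
move=> x; have [M [CM ->]] := iso_class_surj x.
by rewrite cm_add_class; apply/iso_classP; exact: dsum_iso0.
Qed.

HB.instance Definition _ :=
  GRing.isNmodule.Build class_monoid cm_addA cm_addC cm_add0.

Lemma class_monoidD M N (CM : C M) (CN : C N) :
  (iso_class CM : class_monoid) + (iso_class CN : class_monoid)
  = iso_class (class_dsum CM CN).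
Proof. exact: cm_add_class. Qed.

(* Existence and uniqueness of decompositions into indecomposables; both are
   needed for this to be equivalent to V(C) being free abelian. *)
Definition KRSA : Prop :=
  (forall M, C M -> exists n (A : 'I_n -> lmodType R),
     (forall i, C (A i) /\ indecomposable (A i)) /\ mod_iso M (dsums A)) /\
  (forall m n (A : 'I_m -> lmodType R) (B : 'I_n -> lmodType R),
     (forall i, C (A i) /\ indecomposable (A i)) ->
     (forall j, C (B j) /\ indecomposable (B j)) ->
     mod_iso (dsums A) (dsums B) ->
     exists2 f : 'I_m -> 'I_n, bijective f & forall i, mod_iso (A i) (B (f i))).

End Monoid.
End IsoClasses.

Section Submodule.
Variables (R : comNzRingType) (M : lmodType R) (S : set M).

Definition is_submodule : Prop :=
  S 0 /\ forall (a : R) (x y : M), S x -> S y -> S (a *: x + y).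

Hypothesis subS : is_submodule.

Definition submod_pred : {pred M} := fun x => `[< S x >].

Record submod := Submod { submod_val : M; _ : submod_val \in submod_pred }.

HB.instance Definition _ := [isSub for submod_val].
HB.instance Definition _ := [Choice of submod by <:].

Lemma submod_pred_closed : subsemimod_closed submod_pred.
Proof.
case: subS => S0 SD; split; first split.
- exact/asboolP.
- by move=> x y /asboolP Sx /asboolP Sy; apply/asboolP; rewrite -[x]scale1r; exact: SD.
- move=> a x /asboolP Sx; apply/asboolP; rewrite -[_ *: _]addr0; exact: SD.
Qed.

Definition submod_lmod : lmodType R :=
  HB.pack_for (lmodType R) submod
    (GRing.SubChoice_isSubLmodule.Build R M submod_pred submod submod_pred_closed).

Definition submod_incl : submod_lmod -> M := submod_val.

Lemma submod_incl_linear : linear submod_incl.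
Proof. by []. Qed.

HB.instance Definition _ :=
  GRing.isLinear.Build R submod_lmod M _ submod_incl submod_incl_linear.

Lemma submod_inclP (x : submod_lmod) : S (submod_incl x).
Proof. by case: x => x /= /asboolP. Qed.

Lemma submod_incl_inj : injective submod_incl.
Proof. exact: val_inj. Qed.

Definition submod_of (x : M) (Sx : S x) : submod_lmod :=
  Submod (introT (asboolP (S x)) Sx).

End Submodule.

Section Projective.
Variable R : comNzRingType.
Implicit Types M N P : lmodType R.

Lemma fin_gen_iso M N : mod_iso M N -> fin_gen M -> fin_gen N.
Proof.
move=> [f [f' ff' f'f]] [n [g gP]]; exists n, (f \o g) => y.
have [c ec] := gP (f' y); exists c; rewrite -[LHS]f'f ec linear_sum.
by apply: eq_bigr => i _; rewrite linearZ.
Qed.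

Lemma fin_gen_zero : fin_gen (zero_module R).
Proof.
exists 0%N, (fun=> 0) => x; exists (fun=> 0).
by rewrite big_ord0; apply/matrixP => i [].
Qed.

Lemma sum_pair M N n (F : 'I_n -> M) (G : 'I_n -> N) :
  \sum_i ((F i, G i) : dsum M N) = (\sum_i F i, \sum_i G i).
Proof.
elim: n F G => [|n IH] F G; first by rewrite !big_ord0.
by rewrite !big_ord_recr IH.
Qed.

Lemma fin_gen_dsum M N : fin_gen M -> fin_gen N -> fin_gen (dsum M N).
Proof.
move=> [m [g gP]] [n [h hP]].
exists (m + n)%N, (fun i => match fintype.split i with
                   | inl j => (g j, 0) | inr k => (0, h k) end).
case=> x y; have [c ->] := gP x; have [d ->] := hP y.
exists (fun i => match fintype.split i with inl j => c j | inr k => d k end).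
rewrite big_split_ord /=.
rewrite (eq_bigr (fun i => (c i *: g i, 0))); last first.
  by move=> i _; rewrite (unsplitK (inl i)); congr pair; rewrite /= scaler0.
rewrite [X in _ = _ + X](eq_bigr (fun i => (0, d i *: h i))); last first.
  by move=> i _; rewrite (unsplitK (inr i)); congr pair; rewrite /= scaler0.
rewrite !sum_pair !big1_eq.
by congr pair; rewrite /= ?addr0 ?add0r.
Qed.

Lemma projective_iso M N : mod_iso M N -> projective M -> projective N.
Proof.
move=> [f [f' ff' f'f]] pM A B p g p_surj.
have [h hP] := pM A B p (g \o f) p_surj.
have [f'' f''K] : exists f'' : {linear N -> M}, f'' =1 f'.
  have f'l : linear f'.
    by move=> a x y; apply: (can_inj ff'); rewrite f'f linearP !f'f.
  by exists (HB.pack_for {linear N -> M} f' (GRing.isLinear.Build R N M _ f' f'l)).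
by exists (h \o f'') => y; rewrite /= hP /= f''K f'f.
Qed.

Lemma projective_zero : projective (zero_module R).
Proof.
move=> A B p g _; exists (\0 : {linear zero_module R -> A}) => x.
have -> : x = 0 by apply/matrixP => i [].
by rewrite !linear0.
Qed.

Definition dual_basis M : Prop :=
  exists n (g : 'I_n -> M) (phi : 'I_n -> {linear M -> R^o}),
    forall x, x = \sum_i phi i x *: g i.

Lemma dual_basis_fin_gen M : dual_basis M -> fin_gen M.
Proof.
by move=> [n [g [phi gP]]]; exists n, g => x; exists (fun i => phi i x).
Qed.

Lemma dual_basis_projective M : dual_basis M -> projective M.
Proof.
move=> [n [g [phi gP]]] A B p f p_surj.
pose a i := sval (cid (p_surj (f (g i)))).
have aE i : p (a i) = f (g i) by rewrite /a; case: cid.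
pose h x := \sum_i (phi i x : R) *: a i.
have hl : linear h.
  move=> c x y; rewrite /h scaler_sumr -big_split; apply: eq_bigr => i _.
  by rewrite linearP scalerDl scalerA.
exists (HB.pack_for {linear M -> A} h (GRing.isLinear.Build R M A _ h hl)) => x.
rewrite /= [in RHS](gP x) /h !linear_sum; apply: eq_bigr => i _.
by rewrite !linearZ /= aE.
Qed.

Lemma fin_gen_projective_dual_basis M : fin_gen M -> projective M -> dual_basis M.
Proof.
move=> [n [g gP]] pM.
pose p (v : 'rV[R]_n) := \sum_i v 0 i *: g i.
have pl : linear p.
  move=> c x y; rewrite /p scaler_sumr -big_split; apply: eq_bigr => i _.
  by rewrite !mxE scalerDl scalerA.
pose pL := HB.pack_for {linear 'rV[R]_n -> M} p (GRing.isLinear.Build R _ M _ p pl).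
have p_surj y : exists v, pL v = y.
  have [c ->] := gP y; exists (\row_i c i) => /=.
  by apply: eq_bigr => i _; rewrite mxE.
have [h hP] := pM _ _ pL idfun p_surj.
pose phi i (x : M) : R^o := h x 0 i.
have phil i : linear (phi i) by move=> c x y; rewrite /phi linearP !mxE.
exists n, g, (fun i => HB.pack_for {linear M -> R^o} (phi i)
  (GRing.isLinear.Build R M R^o _ (phi i) (phil i))) => x.
by rewrite -[LHS]hP.
Qed.

Lemma projective_dsum M N : projective M -> projective N -> projective (dsum M N).
Proof.
move=> pM pN A B p f p_surj.
pose i0 (x : M) : dsum M N := (x, 0).
have il : linear i0.
  by move=> c x y; congr pair; rewrite /= scaler0 addr0.
pose j0 (x : N) : dsum M N := (0, x).
have jl : linear j0.
  by move=> c x y; congr pair; rewrite /= scaler0 addr0.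
pose i := HB.pack_for {linear M -> dsum M N} i0
  (GRing.isLinear.Build R _ _ _ i0 il).
pose j := HB.pack_for {linear N -> dsum M N} j0
  (GRing.isLinear.Build R _ _ _ j0 jl).
have [h hP] := pM A B p (f \o i) p_surj.
have [k kP] := pN A B p (f \o j) p_surj.
pose u (x : dsum M N) := h x.1 + k x.2.
have ul : linear u by move=> c x y; rewrite /u /= !linearP scalerDr addrACA.
exists (HB.pack_for {linear dsum M N -> A} u (GRing.isLinear.Build R _ A _ u ul)).
case=> x y; rewrite /= /u /= linearD hP kP /= -linearD; congr (f _).
by congr pair; rewrite /= ?addr0 ?add0r.
Qed.

Lemma projective_summand M N : projective (dsum M N) -> projective M.
Proof.
move=> pMN A B p f p_surj.
pose q0 (x : dsum M N) : M := x.1.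
have ql : linear q0 by [].
pose q := HB.pack_for {linear dsum M N -> M} q0
  (GRing.isLinear.Build R _ _ _ q0 ql).
pose i0 (x : M) : dsum M N := (x, 0).
have il : linear i0.
  by move=> c x y; congr pair; rewrite /= scaler0 addr0.
pose i := HB.pack_for {linear M -> dsum M N} i0
  (GRing.isLinear.Build R _ _ _ i0 il).
have [h hP] := pMN A B p (f \o q) p_surj.
by exists (h \o i) => x; rewrite /= hP.
Qed.

Lemma fin_gen_summand M N : fin_gen (dsum M N) -> fin_gen M.
Proof.
move=> [n [g gP]]; exists n, (fun i => (g i).1) => x.
have [c /(congr1 fst) /= ->] := gP (x, 0); exists c.
pose q0 (x : dsum M N) : M := x.1.
have ql : linear q0 by [].
pose q := HB.pack_for {linear dsum M N -> M} q0
  (GRing.isLinear.Build R _ _ _ q0 ql).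
exact: (linear_sum q).
Qed.

(* Representatives: the images of idempotent matrices acting on row vectors. *)
Record idem := Idem {
  idem_size : nat;
  idem_mx : 'M[R]_idem_size;
  idemP : idem_mx *m idem_mx = idem_mx }.

HB.instance Definition _ := gen_eqMixin idem.
HB.instance Definition _ := gen_choiceMixin idem.

Lemma idem_im_submodule (e : idem) :
  is_submodule [set v : 'rV[R]_(idem_size e) | v *m idem_mx e = v].
Proof.
split=> [|a x y /= ex ey]; first by rewrite /= mul0mx.
by rewrite /= mulmxDl -scalemxAl ex ey.
Qed.

Definition idem_im (e : idem) : lmodType R := submod_lmod (idem_im_submodule e).

Lemma idem_im_dual_basis e : dual_basis (idem_im e).
Proof.
case: e => n E EE; set e := Idem EE.
have rE i : row i E *m E = row i E by rewrite -row_mul EE.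
pose phi i (x : idem_im e) : R^o := submod_incl x 0 i.
have phil i : linear (phi i) by move=> c x y; rewrite /phi linearP !mxE.
exists n, (fun i => submod_of (idem_im_submodule e) (rE i)),
  (fun i => HB.pack_for {linear idem_im e -> R^o} (phi i)
     (GRing.isLinear.Build R _ R^o _ (phi i) (phil i))) => x.
apply: submod_incl_inj; rewrite linear_sum -[LHS](submod_inclP x) /=.
by rewrite mulmx_sum_row; apply: eq_bigr.
Qed.

Lemma dual_basis_idem M : dual_basis M -> exists e : idem, mod_iso M (idem_im e).
Proof.
move=> [n [g [phi gP]]].
pose E : 'M[R]_n := \matrix_(i, j) (phi j (g i) : R).
have phiE (x : M) : (\row_j (phi j x : R)) *m E = \row_j phi j x.
  apply/rowP => j; rewrite !mxE [in RHS](gP x) linear_sum; apply: eq_bigr => i _.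
  by rewrite !mxE linearZ.
have EE : E *m E = E.
  apply/row_matrixP => i; rewrite row_mul.
  have -> : row i E = \row_j (phi j (g i) : R) by apply/rowP => j; rewrite !mxE.
  exact: phiE.
exists (Idem EE).
pose f x : idem_im (Idem EE) := submod_of (idem_im_submodule (Idem EE)) (phiE x).
have fl : linear f.
  move=> a x y; apply: submod_incl_inj; rewrite linearP; apply/rowP => j.
  by rewrite !mxE linearP.
exists (HB.pack_for {linear M -> idem_im (Idem EE)} f (GRing.isLinear.Build R _ _ _ f fl)).
exists (fun v : idem_im (Idem EE) =>
  \sum_i (submod_incl v : 'rV[R]_n) 0 i *: g i) => [x|v] /=.
  by rewrite [RHS]gP; apply: eq_bigr => i _; rewrite mxE.
apply: submod_incl_inj; apply/rowP => j.
rewrite -[RHS](congr1 (fun w : 'rV[R]_n => w 0 j) (submod_inclP v)) !mxE linear_sum.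
by apply: eq_bigr => i _; rewrite linearZ mxE.
Qed.

Definition fg_projective M : Prop := fin_gen M /\ projective M.

Lemma idem_im_fg_projective e : fg_projective (idem_im e).
Proof.
split; first exact/dual_basis_fin_gen/idem_im_dual_basis.
exact/dual_basis_projective/idem_im_dual_basis.
Qed.

Lemma fg_projective_idem M :
  fg_projective M -> exists e, mod_iso M (idem_im e).
Proof.
by move=> [fM pM]; apply/dual_basis_idem/fin_gen_projective_dual_basis.
Qed.

Definition proj_class : module_class R.
Proof.
refine (@ModuleClass R
  (SmallClass idem_im_fg_projective fg_projective_idem) _ _ _ _).
- by move=> M N MN [fM pM]; split; [exact: fin_gen_iso fM|exact: projective_iso pM].
- by split; [exact: fin_gen_zero|exact: projective_zero].
- by move=> M N [fM pM] [fN pN]; split;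
    [exact: fin_gen_dsum|exact: projective_dsum].
- by move=> M N [fMN pMN]; split;
    [exact: fin_gen_summand fMN|exact: projective_summand pMN].
Defined.

End Projective.

Section Picard.
Variable R : comNzRingType.
Implicit Types L M N P T : lmodType R.

Definition bilinear_map M N P (b : M -> N -> P) : Prop :=
  (forall n, linear (b^~ n)) /\ (forall m, linear (b m)).

(* b : M x N -> T exhibits T as the tensor product of M and N over R. *)
Definition is_tensor M N T (b : M -> N -> T) : Prop :=
  bilinear_map b /\
  forall P (c : M -> N -> P), bilinear_map c ->
    exists2 h : {linear T -> P}, (forall m n, h (b m n) = c m n) &
      forall k : {linear T -> P}, (forall m n, k (b m n) = c m n) -> k =1 h.

Definition invertible_module L : Prop :=
  exists N (b : L -> N -> R^o), is_tensor b.

Lemma invertible_dual_basis L : invertible_module L -> dual_basis L.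
Proof.
move=> [N [b [[bl br] bU]]].
pose I : set R^o := [set r | exists n (x : 'I_n -> L) (y : 'I_n -> N),
  r = \sum_i b (x i) (y i)].
have bZ a x y : b (a *: x) y = a *: b x y.
  have b0 : b 0 y = 0 by have := bl y (-1) 0 0; rewrite scaler0 addr0 scaleN1r addNr.
  by have := bl y a x 0; rewrite /= b0 !addr0.
have I_sub : is_submodule I.
  split; first by exists 0%N, (fun=> 0), (fun=> 0); rewrite big_ord0.
  move=> a r r' [m [x [y ->]]] [n [x' [y' ->]]].
  exists (m + n)%N,
    (fun i => match fintype.split i with inl j => a *: x j | inr k => x' k end),
    (fun i => match fintype.split i with inl j => y j | inr k => y' k end).
  rewrite big_split_ord scaler_sumr; congr (_ + _); apply: eq_bigr => i _.
    by rewrite (unsplitK (inl i)) bZ.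
  by rewrite (unsplitK (inr i)).
have Ib x y : I (b x y).
  by exists 1%N, (fun=> x), (fun=> y); rewrite big_ord1.
pose c x y : submod_lmod I_sub := submod_of I_sub (Ib x y).
have cb : bilinear_map c.
  by split=> z a x y; apply: submod_incl_inj; rewrite linearP; [apply: bl|apply: br].
have [h hP _] := bU _ c cb.
have bb : bilinear_map b by [].
have [h0 h0P h0U] := bU _ b bb.
have : I 1.
  have hb x y : submod_incl (h (b x y)) = b x y by rewrite hP.
  have /= e := h0U (@submod_incl R R^o I I_sub \o h) hb 1.
  have /= e' := h0U idfun (fun _ _ => erefl) 1.
  by rewrite e' -e; exact: submod_inclP.
move=> [n [x [y e1]]].
have [u uP] : exists u : L -> L, forall z v w, b z w *: v = b v w *: u z.
  suff /choice[u uP] z : exists u, forall v w, b z w *: v = b v w *: u by exists u.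
  have cz : bilinear_map (fun (v : L) w => (b z w : R) *: v).
    split=> [w|v] a s1 s2; first by rewrite scalerDr !scalerA mulrC.
    by rewrite br scalerDl scalerA.
  have [g gP _] := bU _ _ cz; exists (g 1) => v w; rewrite -gP -linearZ.
  by congr (g _); rewrite /GRing.scale /= mulr1.
have phil i : linear (fun v => b v (y i)) by exact: bl.
exists n, (fun i => u (x i)), (fun i => HB.pack_for {linear L -> R^o}
  (fun v => b v (y i)) (GRing.isLinear.Build R L R^o _ _ (phil i))) => v.
rewrite -[LHS]scale1r e1 scaler_suml; apply: eq_bigr => i _ /=; exact: uP.
Qed.

(* The images of idempotent matrices that are invertible modules. *)
Definition inv_idem := {e : idem R | `[< invertible_module (idem_im e) >]}.

Definition inv_idem_im (e : inv_idem) : lmodType R := idem_im (val e).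

Lemma inv_idem_im_invertible e : invertible_module (inv_idem_im e).
Proof. exact/asboolP/(valP e). Qed.

Lemma invertible_module_iso L M :
  mod_iso L M -> invertible_module L -> invertible_module M.
Proof.
move=> LM [N [b [[bl br] bU]]].
have [f [f' ff' f'f]] := LM; have [g [g' gg' g'g]] := mod_iso_sym LM.
exists N, (fun x y => b (g x) y); split.
  split=> [y|x] a s1 s2; last exact: br.
  by rewrite linearP; exact: bl.
move=> P c [cl cr].
have [//|h hP hU] := bU P (fun x y => c (g' x) y).
  split=> [y|x] a s1 s2; last exact: cr.
  have -> : g' (a *: s1 + s2) = a *: g' s1 + g' s2.
    by apply: (can_inj gg'); rewrite g'g linearP !g'g.
  exact: cl.
exists h => [x y|k kP]; first by rewrite hP gg'.
by apply: hU => x y; rewrite -kP g'g.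
Qed.

Lemma invertible_inv_idem L :
  invertible_module L -> exists e, mod_iso L (inv_idem_im e).
Proof.
move=> Li; have [e Le] := dual_basis_idem (invertible_dual_basis Li).
have ei : `[< invertible_module (idem_im e) >].
  by apply/asboolP; exact: invertible_module_iso Le Li.
by exists (exist _ e ei).
Qed.

Definition invertible_class : small_class R :=
  SmallClass inv_idem_im_invertible invertible_inv_idem.

(* The underlying set of Pic(R); its group law, induced by the tensor product,
   plays no role in its finiteness. *)
Definition Pic := iso_classes invertible_class.

End Picard.

(* Monoids are written additively, since V(C) is; cancellativity, part of the
   notion of monoid used here, is a separate predicate. *)
Section Monoids.
Variable H : nmodType.
Implicit Types a b p u : H.

Definition cancellative : Prop := forall a b c, a + b = a + c -> b = c.

Definition mon_unit a : Prop := exists b, a + b = 0.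

Definition mon_dvd a b : Prop := exists c, b = a + c.

Definition mon_assoc a b : Prop := exists2 u, mon_unit u & b = a + u.

Definition mon_atom a : Prop :=
  ~ mon_unit a /\ forall b c, a = b + c -> mon_unit b \/ mon_unit c.

Definition mon_prime p : Prop :=
  ~ mon_unit p /\
  forall a b, mon_dvd p (a + b) -> mon_dvd p a \/ mon_dvd p b.

Definition atomic : Prop :=
  forall a, ~ mon_unit a ->
    exists n (v : 'I_n -> H), (forall i, mon_atom (v i)) /\ a = \sum_i v i.

Definition factorial_monoid : Prop :=
  cancellative /\
  forall a, ~ mon_unit a ->
    exists n (v : 'I_n -> H), (forall i, mon_prime (v i)) /\ a = \sum_i v i.

Definition fin_gen_monoid : Prop :=
  exists n (g : 'I_n -> H),
    forall a, exists k : 'I_n -> nat, a = \sum_i g i *+ k i.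

(* H is the direct product of its unit group and the free abelian monoid on the
   pairwise non-associated primes p_0, ..., p_(s-1). *)
Definition units_times_primes s (p : 'I_s -> H) : Prop :=
  [/\ forall i, mon_prime (p i),
      forall i j, mon_assoc (p i) (p j) -> i = j,
      forall a, exists u (k : 'I_s -> nat),
        mon_unit u /\ a = u + \sum_i p i *+ k i &
      forall u v (k l : 'I_s -> nat), mon_unit u -> mon_unit v ->
        u + \sum_i p i *+ k i = v + \sum_i p i *+ l i -> u = v /\ k =1 l].

End Monoids.

Definition finitely_primary (H : nmodType) (s alpha : nat) : Prop :=
  [/\ (0 < s)%N, (0 < alpha)%N, cancellative H &
    exists (F : nmodType) (p : 'I_s -> F) (iota : {additive H -> F}),
      [/\ factorial_monoid F, units_times_primes p, injective iota,
          forall a : H, ~ mon_unit a -> mon_dvd (\sum_i p i) (iota a) &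
          forall b : F, exists a : H, iota a = (\sum_i p i) *+ alpha + b]].

Section Reduced.
Variable H : nmodType.
Implicit Types a b : H.

Definition assocb a b : bool := `[< mon_assoc a b >].

Lemma mon_unit0 : mon_unit (0 : H).
Proof. by exists 0; rewrite addr0. Qed.

Lemma mon_unitD a b : mon_unit a -> mon_unit b -> mon_unit (a + b).
Proof. by move=> [a' aa'] [b' bb']; exists (a' + b'); rewrite addrACA aa' bb' addr0. Qed.

Lemma assocb_refl : reflexive assocb.
Proof.
by move=> a; apply/asboolP; exists 0; [exact: mon_unit0|rewrite addr0].
Qed.

Lemma assocb_sym : symmetric assocb.
Proof.
suff assocb_impl a b : mon_assoc a b -> mon_assoc b a.
  by move=> a b; apply/asboolP/asboolP; exact: assocb_impl.
move=> [u [u' uu'] ->]; exists u'; first by exists u; rewrite addrC.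
by rewrite -addrA uu' addr0.
Qed.

Lemma assocb_trans : transitive assocb.
Proof.
move=> b a c /asboolP[u uU ->] /asboolP[v vU ->]; apply/asboolP.
by exists (u + v); [exact: mon_unitD|rewrite addrA].
Qed.

Canonical assocb_equiv := EquivRel assocb assocb_refl assocb_sym assocb_trans.

(* H_red: the monoid of cosets a + H^x. *)
Definition Hred := {eq_quot assocb}.
HB.instance Definition _ : EqQuotient _ assocb Hred := EqQuotient.on Hred.
HB.instance Definition _ := Choice.on Hred.

Definition red_coset a : Hred := \pi_Hred a.

Definition addred : Hred -> Hred -> Hred := lift_op2 Hred (@GRing.add H).

Lemma pi_addred : {morph \pi : a b / a + b >-> addred a b}.
Proof.
move=> a b; unlock addred; apply/eqmodP/asboolP.
have repr_assoc (x : H) : mon_assoc x (repr (\pi_Hred x)).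
  by apply/asboolP; have /eqP := esym (reprK (\pi_Hred x)); rewrite eqmodE.
have [u uU eu] := repr_assoc a; have [v vU ev] := repr_assoc b.
by exists (u + v); [exact: mon_unitD|rewrite eu ev addrACA].
Qed.
Canonical pi_addred_morph := PiMorph2 pi_addred.

Lemma addredA : associative addred.
Proof. by elim/quotW=> a; elim/quotW=> b; elim/quotW=> c; rewrite !piE addrA. Qed.

Lemma addredC : commutative addred.
Proof. by elim/quotW=> a; elim/quotW=> b; rewrite !piE addrC. Qed.

Lemma add0red : left_id (red_coset 0) addred.
Proof. by elim/quotW=> a; rewrite /red_coset !piE add0r. Qed.

HB.instance Definition _ := GRing.isNmodule.Build Hred addredA addredC add0red.

Lemma red_cosetD a b : red_coset (a + b) = red_coset a + red_coset b.
Proof. by rewrite /red_coset pi_addred. Qed.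

(* Factorizations of an element of H_red, and of an element of H. *)
Definition fact_red (x : Hred) : set {mset Hred}%mset :=
  [set z : {mset Hred}%mset |
    (forall u, u \in z -> mon_atom u) /\ \sum_(u <- z) u = x].

Definition factorizations a : set {mset Hred}%mset := fact_red (red_coset a).

Definition length_set a : set nat := [set size z | z in factorizations a].

Definition half_factorial : Prop :=
  atomic H /\ forall a, exists n, length_set a = [set n].

End Reduced.

(* The smallest n with P n, in nat extended by infinity, which is [None]. *)
Definition least (P : nat -> Prop) : option nat :=
  if pselect (exists n, `[< P n >]) is left exP then Some (ex_minn exP) else None.

Definition le_ext (x : option nat) (n : nat) : Prop :=
  if x is Some m then (m <= n)%N else False.

Definition sup_ext (A : set (option nat)) : option nat :=
  least (fun n => forall x, A x -> le_ext x n).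

Section Degrees.
Variable H : nmodType.
Implicit Types z : {mset Hred H}%mset.

Definition fact_dist z z' : nat :=
  maxn (size (z `\` (z `&` z'))%mset) (size (z' `\` (z `&` z'))%mset).

Definition chain_connected (a : H) (N : nat) : Prop :=
  forall z z', factorizations a z -> factorizations a z' ->
    exists k (c : nat -> {mset Hred H}%mset),
      [/\ c 0%N = z, c k = z',
          forall i, (i <= k)%N -> factorizations a (c i) &
          forall i, (i < k)%N -> (fact_dist (c i) (c i.+1) <= N)%N].

Definition elt_catenary_degree (a : H) : option nat := least (chain_connected a).

Definition catenary_degree : option nat :=
  sup_ext [set elt_catenary_degree a | a in [set: H]].

(* v is the subproduct v_1 ... v_m, and u + w is its refactorization, with
   w = u_2 ... u_l. *)
Definition tame_bound (u : Hred H) (N : nat) : Prop :=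
  forall (a : Hred H) z, mon_dvd u a -> fact_red a z -> u \notin z ->
    exists v w : {mset Hred H}%mset,
      [/\ (v `<=` z)%mset,
          forall x, x \in w -> mon_atom x,
          \sum_(x <- v) x = u + \sum_(x <- w) x &
          (maxn (size w).+1 (size v) <= N)%N].

Definition elt_tame_degree (u : Hred H) : option nat := least (tame_bound u).

Definition tame_degree : option nat :=
  sup_ext [set elt_tame_degree u | u in [set u | mon_atom u]].

End Degrees.

(* Main.v *)
(* The zero-divisors lie in the Jacobson radical. Hence a nonzero projective
   module, the image of an idempotent matrix E, has a coordinate functional with
   a regular value (otherwise all entries of E would be in the radical, so that
   1 - E would be invertible and E = 0); its image is a finitely generated
   regular ideal, hence invertible, and splits off. By the 1 1/2 generator
   property I + J = R + L for invertible I and J, so that every module of rank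
   n > 0 is R^(n-1) + L with L of rank one, and L is determined by the
   determinant of an isomorphism. Thus V is {0} together with N x Pic(R), and
   the atoms are the classes of rank one; as their inverses already exist in V up
   to a free summand, the group law of Pic(R) is never needed. *)
Require Import Defs.
From HB Require Import structures.
From mathcomp Require Import all_boot all_algebra finmap multiset.
From mathcomp Require Import ring zify.
From mathcomp Require Import boolp classical_sets cardinality.

Set Implicit Arguments.
Unset Strict Implicit.
Unset Printing Implicit Defensive.

Import GRing.Theory.
Local Open Scope ring_scope.
Local Open Scope classical_set_scope.

(** * Maximal ideals and the Jacobson radical *)

(** One residue field R/M suffices for the rank: a nonzero projective module splits off an
    invertible ideal, and such an ideal has rank one over every residue field, so the rank at M
    already detects zero. The obstacle to cancelling R^n is that the ideals are not free; the
    determinant of an isomorphism is therefore taken in a frame that becomes a basis only after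
    inverting a regular element. The arithmetic of V uses only [ranked_monoid]: an additive rank and
    a cancellable element p of rank one, some multiple of which is divisible by any given element.
    The factorial overmonoid required of a finitely primary monoid is found inside V: the elements
    of positive rank under x + y - p, with the embedding x |-> x + p. The shift by a single p is the
    origin of the exponent 1. The lower bounds 2 come from a rank one class g other than p, which
    exists when KRSA fails: its inverse h gives the two factorizations g + h = p + p. *)

Section MaximalIdeals.
Variable R : comNzRingType.
Implicit Types (I J M : set R) (a x : R).

Lemma ideal_1 I : ideal I -> I 1 -> I = setT.
Proof.
by move=> [_ _ IM] I1; apply/seteqP; split=> // x _; rewrite -[x]mulr1; exact: IM.
Qed.

Lemma ideal_mull I a x : ideal I -> I x -> I (a * x).
Proof. by case=> _ _; exact. Qed.

Lemma ideal_mulr I a x : ideal I -> I x -> I (x * a).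
Proof. by rewrite mulrC; exact: ideal_mull. Qed.

Lemma ideal_sum I n (F : 'I_n -> R) : ideal I -> (forall i, I (F i)) -> I (\sum_i F i).
Proof. by move=> [I0 ID _] IF; elim/big_ind : _. Qed.

Lemma ideal_ideal_add I a : ideal I -> ideal (ideal_add I (principal a)).
Proof.
move=> [I0 ID IM]; split.
- by exists 0, 0; split; rewrite ?addr0 //; exists 0; rewrite mul0r.
- move=> _ _ [y [_ [Iy [c ->] ->]]] [y' [_ [Iy' [c' ->] ->]]].
  exists (y + y'), ((c + c') * a); split; [exact: ID|by exists (c + c')|ring].
- move=> b _ [y [_ [Iy [c ->] ->]]].
  exists (b * y), (b * c * a); split; [exact: IM|by exists (b * c)|ring].
Qed.

Lemma maximal_ideal_comax M x : maximal_ideal M -> ~ M x ->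
  ideal_add M (principal x) = setT.
Proof.
move=> [idM MT Mmax] Mx; have [|y My|e|//] := Mmax (ideal_add M (principal x)).
- exact: ideal_ideal_add.
- exists y, 0; split; rewrite ?addr0 //; first by exists 0; rewrite mul0r.
case: Mx; rewrite -e; exists 0, x; split; rewrite ?add0r //; first by case: idM.
by exists 1; rewrite mul1r.
Qed.

Lemma nonunit_maximal a : (forall b, b * a <> 1) ->
  exists2 M, maximal_ideal M & M a.
Proof.
move=> a_nu.
pose P I := I = set0 \/ [/\ ideal I, I a & ~ I 1].
have [F FP Ftot|M [PM Mmax]] := @Zorn_bigcup R P.
  have [[I FI Ia]|nFa] := pselect (exists2 I, F I & I a); last first.
    left; apply/seteqP; split=> // x [I FI Ix].
    by case: (FP _ FI) => [I0|[_ Ia _]]; [rewrite -I0|case: nFa; exists I].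
  right; split; last 2 first.
  - by exists I.
  - move=> [J FJ J1]; case: (FP _ FJ) => [J0|[_ _]] //.
    by move: J1; rewrite J0.
  split.
  - by exists I => //; case: (FP _ FI) => [I0|[[]]]; first by move: Ia; rewrite I0.
  - move=> x y [J FJ Jx] [K FK Ky].
    have [JK|KJ] := Ftot _ _ FJ FK.
      exists K => //; case: (FP _ FK) => [K0|[[_ KD _] _ _]]; first by move: Ky; rewrite K0.
      by apply: KD => //; exact: JK.
    exists J => //; case: (FP _ FJ) => [J0|[[_ JD _] _ _]]; first by move: Jx; rewrite J0.
    by apply: JD => //; exact: KJ.
  - move=> c x [J FJ Jx]; exists J => //.
    by case: (FP _ FJ) => [J0|[[_ _ JM] _ _]]; [move: Jx; rewrite J0|exact: JM].
have Pa : P (principal a).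
  right; split; [split| |].
  - by exists 0; rewrite mul0r.
  - by move=> _ _ [b ->] [c ->]; exists (b + c); rewrite mulrDl.
  - by move=> c _ [b ->]; exists (c * b); rewrite mulrA.
  - by exists 1; rewrite mul1r.
  - by move=> [b /esym]; exact: a_nu.
case: PM => [M0|[idM Ma M1]].
  case: (Mmax (principal a)) => //; rewrite M0; split=> [x //|/(_ 0)].
  by apply; exists 0; rewrite mul0r.
exists M => //; split=> // [MT|J idJ MJ]; first by apply: M1; rewrite MT.
have [J1|J1] := pselect (J 1); first by right; exact: ideal_1.
left; apply: contrapT => JM; apply: (Mmax J); last by right; split=> //; exact: MJ.
by split=> // JM'; apply: JM; apply/seteqP.
Qed.

Lemma residue_field M : maximal_ideal M ->
  exists (K : fieldType) (f : {rmorphism R -> K}), forall x, f x = 0 <-> M x.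
Proof.
move=> maxM; have [idM MT _] := maxM; have [M0 MD MM] := idM.
pose P : {pred R} := fun x => `[< M x >].
have Pcl : idealr_closed P.
  split; [exact/asboolP| |].
    by apply/asboolPn => M1; apply: MT; exact: ideal_1.
  by move=> a x y /asboolP Mx /asboolP My; apply/asboolP; apply: MD => //; exact: MM.
pose I : idealr R := HB.pack_for (idealr R) (P : R -> bool) (isIdealr.Build R P Pcl).
pose Q : comNzRingType := {ideal_quot I}.
pose f : {rmorphism R -> Q} := \pi_({ideal_quot I})%qT.
have fE x : f x = 0 <-> M x.
  rewrite -[0](rmorph0 f); split.
    move=> /eqP e; apply/asboolP; move: e.
    by rewrite -Quotient.idealrBE subr0.
  by move=> Mx; apply/eqP; rewrite -Quotient.idealrBE subr0; exact/asboolP.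
(* For q = f x nonzero, M + (x) = R and the coefficient of x in a representation of 1 gives the
   inverse; zero is inverted to zero, as the field structure demands. *)
have inv_ex (q : Q) : exists q', (q != 0 -> q' * q = 1) /\ (q = 0 -> q' = 0).
  have [->|q0] := eqVneq q 0; first by exists 0.
  have [x ex] : exists x, q = f x by exists (repr q); rewrite /f /= reprK.
  have Mx : ~ M x by move=> /fE; rewrite -ex => /eqP; rewrite (negbTE q0).
  have [y [_ [My [c ->] e1]]] : ideal_add M (principal x) 1.
    by rewrite maximal_ideal_comax.
  exists (f c); split=> [_|/eqP]; last by rewrite (negbTE q0).
  rewrite ex -rmorphM -[RHS](rmorph1 f) e1 rmorphD.
  by have /fE -> := My; rewrite add0r.
pose inv q := sval (cid (inv_ex q)).
have invV q : q != 0 -> inv q * q = 1 by rewrite /inv; case: cid => ? [].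
have inv0 : inv 0 = 0 by exact: (svalP (cid (inv_ex 0))).2.
pose K : fieldType := HB.pack_for fieldType Q
  (GRing.ComNzRing_isField.Build Q invV inv0).
by exists K, f.
Qed.

Lemma ideal_jacobson_radical : ideal (jacobson_radical R).
Proof.
split=> [I [[]]//|x y Jx Jy I maxI|a x Jx I maxI]; have [[_ ID IM] _ _] := maxI.
  by apply: ID; [exact: Jx|exact: Jy].
by apply: IM; exact: Jx.
Qed.

Lemma maximal_ideal_ex : exists M, @maximal_ideal R M.
Proof.
have [|M maxM _] := @nonunit_maximal 0; last by exists M.
by move=> b /eqP; rewrite mulr0 eq_sym oner_eq0.
Qed.

Lemma jacobson_radicalN1 : ~ jacobson_radical R 1.
Proof.
have [M maxM] := maximal_ideal_ex; move=> /(_ M maxM) M1.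
by have [idM + _] := maxM; apply; exact: ideal_1.
Qed.

(** The determinant d of 1 - E kills E, because adj(1 - E)(1 - E)E = 0, and d is a unit, because it
    maps to 1 in every residue field. *)
Lemma idem_jacobson_radical n (E : 'M[R]_n) : E *m E = E ->
  (forall i j, jacobson_radical R (E i j)) -> E = 0.
Proof.
move=> EE EJ; pose d := \det (1%:M - E).
have [[b bd]|nu] := pselect (exists b, b * d = 1).
  have dE : d *: E = 0.
    by rewrite -mul_scalar_mx -mul_adj_mx -mulmxA mulmxBl mul1mx EE subrr mulmx0.
  by rewrite -[E]scale1r -bd -scalerA dE scaler0.
have [|M maxM Md] := @nonunit_maximal d; first by move=> b bd; apply: nu; exists b.
have [K [f fE]] := residue_field maxM.
have /fE := Md; rewrite -det_map_mx map_mxB map_mx1.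
have -> : map_mx f E = 0.
  by apply/matrixP => i j; rewrite !mxE; apply/fE; exact: EJ.
by rewrite subr0 det1 => /eqP; rewrite oner_eq0.
Qed.

(** A zero-divisor outside a maximal ideal M would be comaximal with M, and smallness would then
    give M = R. *)
Lemma small_zero_divisors_regular a : small_zero_divisors R ->
  ~ jacobson_radical R a -> GRing.lreg a.
Proof.
move=> small aJ; apply: contrapT => a_nreg; apply: aJ => M maxM.
apply: contrapT => Ma; have [idM MT _] := maxM; apply: MT.
apply: (small a) => //; last exact: maximal_ideal_comax.
apply: contrapT => a_nzd; apply: a_nreg => x y axy; apply/eqP; rewrite -subr_eq0.
apply: contra_notT a_nzd => xy0; exists (x - y) => //.
by rewrite mulrBr axy subrr.
Qed.

End MaximalIdeals.

(** * Split surjections *)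

Section Linear.
Variable R : comNzRingType.
Implicit Types M N P : lmodType R.

Definition linear_of M N (h : M -> N) (hl : linear h) : {linear M -> N} :=
  HB.pack_for {linear M -> N} h (GRing.isLinear.Build R M N _ h hl).

Lemma mod_isoP M N : mod_iso M N ->
  exists (f : {linear M -> N}) (g : {linear N -> M}), cancel f g /\ cancel g f.
Proof.
move=> [f [g fg gf]].
have gl : linear g by move=> a x y; apply: (can_inj fg); rewrite gf linearP !gf.
by exists f, (linear_of gl).
Qed.

Lemma split_mod_iso M N (f : {linear M -> N}) (s : {linear N -> M}) :
  cancel s f -> exists K, mod_iso M (dsum N K).
Proof.
move=> sf; have kerS : is_submodule [set x | f x = 0].
  by split=> [|a x y /= fx fy]; rewrite /= ?linear0 // linearP fx fy scaler0 addr0.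
have fK x : f (x - s (f x)) = 0 by rewrite linearB sf subrr.
pose h x : dsum N (submod_lmod kerS) := (f x, submod_of kerS (fK x)).
have hl : linear h.
  move=> a x y; congr pair; first exact: linearP.
  apply: submod_incl_inj; rewrite [RHS]linearP.
  change (a *: x + y - s (f (a *: x + y)) = a *: (x - s (f x)) + (y - s (f y))).
  by rewrite !linearP scalerDr addrACA.
exists (submod_lmod kerS), (linear_of hl), (fun p => s p.1 + submod_incl p.2).
  by move=> x; rewrite /= addrC subrK.
move=> [y k] /=; have fk : f (submod_incl k) = 0 := submod_inclP k.
have fy : f (s y + submod_incl k) = y by rewrite linearD sf fk addr0.
congr pair => //; apply: submod_incl_inj; rewrite /= fy addrC addKr //.
Qed.

Lemma sum_scale_linear M N n (g : 'I_n -> N) (phi : 'I_n -> {linear M -> R^o}) :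
  linear (fun x => \sum_i (phi i x : R) *: g i).
Proof.
move=> a x y; rewrite scaler_sumr -big_split; apply: eq_bigr => i _ /=.
by rewrite linearP scalerDl scalerA.
Qed.

End Linear.

(** * Invertible ideals *)

Section InvertibleIdeals.
Variable R : comNzRingType.
Implicit Types (I J : set R) (M N : lmodType R).

Lemma ideal_submodule I : ideal I -> is_submodule (I : set R^o).
Proof.
by move=> [I0 ID IM]; split=> // a x y Ix Iy; apply: ID => //; exact: IM.
Qed.

Definition ideal_mod I (idI : ideal I) : lmodType R := submod_lmod (ideal_submodule idI).

Lemma total_quotient_eq (x y : R) : x%:Q0 = y%:Q0 -> x = y.
Proof.
move=> /eqP; rewrite /TotalQuotient.ofR eqmodE => /eqP /=.
by rewrite !mulr1.
Qed.

Lemma total_quotient_den (q : total_quotient R) :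
  exists s a : R, GRing.lreg s /\ q * s%:Q0 = a%:Q0.
Proof.
elim/quotW: q => -[a s sP]; exists s, a; split=> //.
rewrite /TotalQuotient.ofR -[LHS]TotalQuotient.pi_mul.
by apply/eqP; rewrite eqmodE; apply/eqP => /=; ring.
Qed.

Lemma total_quotient_common_den n (q : 'I_n -> total_quotient R) :
  exists (d : R) (r : 'I_n -> R), GRing.lreg d /\ forall i, q i * d%:Q0 = (r i)%:Q0.
Proof.
have /choice[s /choice[a saP]] i := total_quotient_den (q i).
exists (\prod_i s i), (fun i => a i * \prod_(j | j != i) s j); split.
  elim/big_ind : _ => [|x y|i _]; [exact: lreg1|exact: lregM|by case: (saP i)].
move=> i; rewrite (bigD1 i) //= !rmorphM mulrA.
by case: (saP i) => _ ->.
Qed.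

(* The inverse of I is spanned by the fractions r_i / d. *)
Definition inverse_basis I (d : R) n (x r : 'I_n -> R) :=
  [/\ GRing.lreg d, forall i, I (x i), \sum_i x i * r i = d &
      forall i y, I y -> exists t, y * r i = t * d].

Lemma invertible_inverse_basis I : invertible_ideal I ->
  exists d n (x r : 'I_n -> R), inverse_basis I d x r.
Proof.
move=> [idI e].
have [n [a [q [aI qI e1]]]] :
    set_prod [set x%:Q0 | x in I] (ideal_inv I) (1 : R)%:Q0 by rewrite e; exists 1.
have /choice[x xP] i : exists x, I x /\ x%:Q0 = a i.
  by have [x Ix <-] := aI i; exists x.
have [d [r [dreg dr]]] := total_quotient_common_den q.
exists d, n, x, r; split=> // [i||i y Iy]; first by case: (xP i).
  have {}e1 : 1 = \sum_i a i * q i := e1.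
  apply: total_quotient_eq; rewrite -[RHS]mul1r e1 mulr_suml rmorph_sum.
  apply: eq_bigr => i _; rewrite rmorphM /= -dr.
  by have [_ <-] := xP i; rewrite mulrA.
have [t et] := qI i y Iy; exists t; apply: total_quotient_eq.
by rewrite !rmorphM /= -et -dr; ring.
Qed.

Section InverseBasis.
Variables (I : set R) (idI : ideal I) (d : R) (n : nat) (x r : 'I_n -> R).
Hypothesis Ib : inverse_basis I d x r.

Lemma regular_inverse_basis : I d.
Proof.
have [_ Ix <- _] := Ib; apply: ideal_sum => // i; exact: ideal_mulr.
Qed.

(* y lies in d I^-1. *)
Definition codiff (y : R) := forall z, I z -> exists t, z * y = t * d.

(** The functional is multiplication by the fraction y / d, which carries I into R. *)
Lemma codiff_form (y : R) : codiff y ->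
  exists phi : {linear ideal_mod idI -> R^o},
    forall z, (phi z : R) * d = submod_incl z * y.
Proof.
have [dreg _ _ _] := Ib.
move=> yP; have /choice[phi phiP] (z : ideal_mod idI) :
  exists t, t * d = submod_incl z * y.
  by have [t] := yP _ (submod_inclP z); exists t.
have phil : linear (phi : ideal_mod idI -> R^o).
  move=> a u v; apply: dreg; rewrite mulrC phiP linearP /=.
  have eu := phiP u; have ev := phiP v.
  rewrite /GRing.scale /= mulrDl -mulrA -eu -ev; ring.
by exists (linear_of phil).
Qed.

(** The functionals are multiplication by r_i / d and form a dual basis. The last clause, trace one,
    is what later yields values outside the radical and excludes rank zero. *)
Lemma inverse_basis_mod : exists (g : 'I_n -> ideal_mod idI)
    (psi : 'I_n -> {linear ideal_mod idI -> R^o}),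
  [/\ forall i, submod_incl (g i) = x i,
      forall i z, (psi i z : R) * d = submod_incl z * r i,
      forall z, \sum_i (psi i z : R) *: g i = z &
      \sum_i (psi i (g i) : R) = 1].
Proof.
have [dreg Ix xr rI] := Ib.
have /choice[psi psiP] i := codiff_form (rI i).
exists (fun i => submod_of (ideal_submodule idI) (Ix i : I (x i))), psi; split=> // [z|].
  apply: submod_incl_inj; apply: dreg; rewrite linear_sum /= mulrC mulr_suml.
  rewrite -[in RHS]xr mulr_suml; apply: eq_bigr => i _.
  rewrite -[_ *: (x i : R^o)]/((psi i z : R) * x i) mulrAC psiP; ring.
apply: dreg; rewrite mulrC mulr_suml mulr1 -[RHS]xr.
by apply: eq_bigr => i _; rewrite psiP.
Qed.

(** The tensor partner is d I^-1, a copy of I^-1 inside R, with pairing u v / d. A bilinear c is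
    recovered as b(u, v) times the fixed element sum c(g_i, g'_i). *)
Lemma inverse_basis_invertible_module : invertible_module (ideal_mod idI).
Proof.
have [dreg _ xr rI] := Ib.
pose J : set R := codiff.
have idJ : ideal J.
  split=> [z Iz|y y' Jy Jy' z Iz|a y Jy z Iz].
  - by exists 0; rewrite mulr0 mul0r.
  - have [t et] := Jy z Iz; have [t' et'] := Jy' z Iz.
    by exists (t + t'); rewrite mulrDr et et' mulrDl.
  - by have [t et] := Jy z Iz; exists (a * t); rewrite mulrCA et mulrA.
pose N := ideal_mod idJ.
have [g [psi [gE psiE gP _]]] := inverse_basis_mod.
have bE (u : ideal_mod idI) (v : N) : exists t : R, t * d = submod_incl u * submod_incl v.
  by have [t] := (submod_inclP v : J _) _ (submod_inclP u); exists t.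
have /choice[b0 b0P] (uv : ideal_mod idI * N) := bE uv.1 uv.2.
pose b u v : R^o := b0 (u, v).
have bP u v : (b u v : R) * d = submod_incl u * submod_incl v by exact: b0P.
pose g' i : N := submod_of (ideal_submodule idJ) (rI i : J (r i)).
have bg v : \sum_i (b (g i) v : R) *: g' i = v.
  apply: submod_incl_inj; apply: dreg; rewrite linear_sum /= mulrC mulr_suml.
  rewrite -[in RHS]xr mulr_suml; apply: eq_bigr => i _.
  rewrite -[_ *: (r i : R^o)]/((b (g i) v : R) * r i) mulrAC bP gE; ring.
(* All of this takes place inside the commutative ring R, so u and w can be exchanged; this is what
   carries the scalars from one argument of c to the other. *)
have bswap u v w : (b u v : R) *: w = (b w v : R) *: u.
  have bd (u' w' : ideal_mod idI) : (submod_incl ((b u' v : R) *: w') : R) * d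
      = submod_incl u' * submod_incl v * submod_incl w'.
    by rewrite -[submod_incl (_ *: w')]/((b u' v : R) * submod_incl w') mulrAC bP.
  by apply: submod_incl_inj; apply: dreg; rewrite mulrC bd [RHS]mulrC bd; ring.
exists N, b; split; first split=> [v|u] a s t.
- change ((b (a *: s + t) v : R) = a * b s v + b t v).
  apply: dreg; rewrite mulrC [RHS]mulrC mulrDl -mulrA !bP.
  rewrite -[submod_incl _]/(a * (submod_incl s : R) + submod_incl t); ring.
- change ((b u (a *: s + t) : R) = a * b u s + b u t).
  apply: dreg; rewrite mulrC [RHS]mulrC mulrDl -mulrA !bP.
  rewrite -[submod_incl (a *: s + t)]/(a * (submod_incl s : R) + submod_incl t); ring.
move=> P c [cl cr].
have cZl a u v : c (a *: u) v = a *: c u v.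
  have c0 : c 0 v = 0 by have := cl v (-1) 0 0; rewrite scaler0 addr0 scaleN1r addNr.
  by have := cl v a u 0; rewrite /= c0 !addr0.
have cZr a u v : c u (a *: v) = a *: c u v.
  exact: (linearZ_LR (linear_of (cr u))).
pose h (t : R^o) : P := (t : R) *: \sum_i c (g i) (g' i).
have hl : linear h by move=> a s t; rewrite /h scalerDl scalerA.
exists (linear_of hl) => [u v|k kP t].
  rewrite /= /h scaler_sumr -[in RHS](bg v).
  have -> : c u (\sum_i (b (g i) v : R) *: g' i) = \sum_i c u ((b (g i) v : R) *: g' i).
    exact: (linear_sum (linear_of (cr u))).
  apply: eq_bigr => i _.
  by rewrite -cZl bswap cZl -cZr.
rewrite /= /h -[t in LHS]mulr1 -[t * 1]/(t *: (1 : R^o)) linearZ /=.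
congr (_ *: _).
have -> : (1 : R^o) = \sum_i b (g i) (g' i).
  apply: dreg; rewrite mulr1 mulrC mulr_suml -[LHS]xr; apply: eq_bigr => i _.
  by rewrite bP gE.
by rewrite linear_sum; apply: eq_bigr.
Qed.

End InverseBasis.

End InvertibleIdeals.

(** * Splitting off invertible ideals and free summands *)

Section Splitting.
Variable R : comNzRingType.
Implicit Types (I J : set R) (M N : lmodType R).

Lemma sum_jacobson_radical n (F : 'I_n -> R) : ~ jacobson_radical R (\sum_i F i) ->
  exists i, ~ jacobson_radical R (F i).
Proof.
apply: contra_notP => /forallNP FJ; apply: ideal_sum; first exact: ideal_jacobson_radical.
by move=> i; apply: contrapT; exact: FJ.
Qed.

(** Multiplication by r / d maps J into R, hence rad(R) J into rad(R). A value outside the radical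
    thus certifies the non-membership that the 1 1/2 generator property asks for. *)
Lemma jacobson_radical_prod_coeff J (d r u s : R) : GRing.lreg d ->
  (forall y, J y -> exists t, y * r = t * d) ->
  set_prod (jacobson_radical R) J u -> u * r = s * d -> jacobson_radical R s.
Proof.
move=> dreg Jr [n [a [b [aJ bJ ->]]]] /esym e.
have /choice[t tP] i := Jr _ (bJ i).
have -> : s = \sum_i a i * t i.
  apply: dreg; rewrite mulrC e mulr_suml mulr_sumr; apply: eq_bigr => i _.
  by rewrite -mulrA tP; ring.
have idR := ideal_jacobson_radical R.
by apply: ideal_sum => // i; exact: ideal_mulr (aJ i).
Qed.

Lemma idem_im_eq0 (e : idem R) : idem_mx e = 0 -> mod_iso (idem_im e) (zero_module R).
Proof.
move=> e0; exists \0, (fun=> 0) => x; last by apply/matrixP => k [].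
apply: submod_incl_inj; rewrite linear0; have := submod_inclP x.
by move: (submod_incl x : 'rV_(idem_size e)) => v /= <-; rewrite e0 mulmx0.
Qed.

Lemma fg_projective_split M : prufer_ring R -> small_zero_divisors R ->
  fg_projective M -> ~ mod_iso M (zero_module R) ->
  exists I (idI : ideal I) N,
    invertible_ideal I /\ mod_iso M (dsum (ideal_mod idI) N).
Proof.
move=> prufer small /fg_projective_idem[e Me] M0.
suff [I [idI [N [invI eN]]]] : exists I (idI : ideal I) N,
    invertible_ideal I /\ mod_iso (idem_im e) (dsum (ideal_mod idI) N).
  by exists I, idI, N; split=> //; exact: mod_iso_trans eN.
have {Me M0} e0 : ~ mod_iso (idem_im e) (zero_module R).
  by move=> ?; apply: M0; exact: mod_iso_trans Me _.
case: e e0 => n E EE /= e0; set e := Idem EE in e0 *.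
have [i [j Eij]] : exists i j, ~ jacobson_radical R (E i j).
  apply: contrapT => EJ; apply: e0; apply: idem_im_eq0.
  apply: idem_jacobson_radical => // i j; apply: contrapT => Eij.
  by apply: EJ; exists i, j.
(* I is the image of the j-th coordinate functional: the j-th column of E generates it, and it
   contains the regular entry E i j. *)
pose I : set R := [set y | exists2 v : 'rV_n, v *m E = v & y = v 0 j].
have idI : ideal I.
  split=> [|_ _ [v vE ->] [w wE ->]|a _ [v vE ->]].
  - by exists 0; rewrite ?mul0mx ?mxE.
  - by exists (v + w); rewrite ?mulmxDl ?vE ?wE ?mxE.
  - by exists (a *: v); rewrite -?scalemxAl ?vE ?mxE.
have fgI : fin_gen_ideal I.
  exists n, (fun k => E k j); apply/seteqP; split=> [_ [v vE ->]|_ [c ->]].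
    by exists (v 0) => /=; rewrite -[in LHS]vE mxE.
  exists ((\row_k c k) *m E); first by rewrite -mulmxA EE.
  by rewrite mxE; apply: eq_bigr => k _; rewrite mxE.
have IE : I (E i j).
  by exists (row i E); [rewrite -row_mul EE|rewrite mxE].
have invI : invertible_ideal I.
  apply: prufer => //; exists (E i j) => //; exact: small_zero_divisors_regular.
have [d [m [x [r Ib]]]] := invertible_inverse_basis invI.
have [g [psi [gE _ gP _]]] := inverse_basis_mod idI Ib.
have vI (v : idem_im e) : I ((submod_incl v : 'rV_n) 0 j).
  by exists (submod_incl v) => //; exact: submod_inclP v.
pose f (v : idem_im e) : ideal_mod idI := submod_of (ideal_submodule idI) (vI v).
have fl : linear f.
  by move=> a v w; apply: submod_incl_inj; rewrite [RHS]linearP; rewrite /submod_incl /= !mxE.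
(* Lifting the generators of the dual basis of I gives a section of the surjection f. *)
have /choice[v vP] k : exists v : idem_im e, f v = g k.
  have [v vE ve] := submod_inclP (g k) : I _.
  by exists (submod_of (idem_im_submodule e) (vE : [set _ | _] v)); exact: submod_incl_inj.
pose s := linear_of (sum_scale_linear v psi).
have sf : cancel s (linear_of fl).
  move=> y; rewrite -[RHS]gP [LHS]linear_sum; apply: eq_bigr => k _.
  by rewrite linearZ; congr (_ *: _); exact: vP.
have [N eN] := split_mod_iso sf.
by exists I, idI, N.
Qed.

(* Choosing c in the trace of I outside the radical makes a := c w_l a generator
   candidate for J; then J = (a, b) produces a unimodular element of I + J. *)
Lemma invertible_dsum_split I J (idI : ideal I) (idJ : ideal J) :
  one_half_generator R -> small_zero_divisors R ->
  invertible_ideal I -> invertible_ideal J ->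
  exists L, mod_iso (dsum (ideal_mod idI) (ideal_mod idJ)) (dsum (R^o : lmodType R) L).
Proof.
move=> half small invI invJ.
have [d [m [x [r Ib]]]] := invertible_inverse_basis invI.
have [d' [n [w [q Jb]]]] := invertible_inverse_basis invJ.
have [g [psi [_ _ _ psi1]]] := inverse_basis_mod idI Ib.
have [h [phi [hE phiE hP phi1]]] := inverse_basis_mod idJ Jb.
have [k ck] : exists k, ~ jacobson_radical R (psi k (g k)).
  by apply: sum_jacobson_radical; rewrite psi1; exact: jacobson_radicalN1.
set c : R := psi k (g k) in ck.
(* The trace of J is multiplied by c before a term is selected: the radical need not be prime, so
   two factors chosen separately outside it could have their product inside. *)
have [l cl] : exists l, ~ jacobson_radical R (c * phi l (h l)).
  by apply: sum_jacobson_radical; rewrite -mulr_sumr phi1 mulr1.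
have [dreg' Jw _ Jq] := Jb.
pose a := c * w l.
have aq : a * q l = (c * phi l (h l)) * d'.
  by rewrite -[RHS]mulrA phiE hE mulrA.
have areg : GRing.lreg a.
  suff qa : GRing.lreg (q l * a) by move=> y z e; apply: qa; rewrite /= -[LHS]mulrA e mulrA.
  by rewrite mulrC aq; apply: GRing.lregM => //; exact: small_zero_divisors_regular.
have [|b Jab] := half J a invJ areg (ideal_mull c idJ (Jw l)).
  by move=> aJ; apply: cl; exact: jacobson_radical_prod_coeff dreg' (Jq l) aJ aq.
have Jb' : J b.
  rewrite Jab; exists 0, b; split; rewrite ?add0r //; first by exists 0; rewrite mul0r.
  by exists 1; rewrite mul1r.
pose b' : ideal_mod idJ := submod_of (ideal_submodule idJ) (Jb' : (J : set R^o) b).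
have /choice[al /choice[be hab]] i :
    exists al be, h i = (al * c) *: h l + be *: b' :> ideal_mod idJ.
  have : J (w i) by []; rewrite {1}Jab => -[_ [_ [[al ->] [be ->] e]]].
  exists al, be; apply: submod_incl_inj; rewrite linearP hE e; congr (_ + _).
  transitivity (al * c * (submod_incl (h l) : R)); last by [].
  by rewrite hE mulrA.
(* Applying phi i to the expression of h i and summing over the trace of J gives 1 = ga c + sum be_i
   phi_i(b'). The right side is the value at (g k, b') of the functional [Phi] defined next. *)
pose ga := \sum_i al i * (phi i (h l) : R).
pose Phi (p : dsum (ideal_mod idI) (ideal_mod idJ)) : R^o :=
  ga * (psi k p.1 : R) + \sum_i be i * (phi i p.2 : R).
have Phil : linear Phi.
  move=> t p p'.
  change (Phi (t *: p + p') = t * Phi p + Phi p' :> R); rewrite /Phi.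
  have -> : psi k (t *: p + p').1 = t * (psi k p.1 : R) + psi k p'.1 :> R.
    exact: linearP.
  have -> : \sum_i be i * (phi i (t *: p + p').2 : R) =
      t * (\sum_i be i * (phi i p.2 : R)) + \sum_i be i * (phi i p'.2 : R).
    rewrite mulr_sumr -big_split; apply: eq_bigr => i _ /=.
    have -> : phi i (t *: p.2 + p'.2) = t * (phi i p.2 : R) + phi i p'.2 :> R.
      exact: linearP.
    by ring.
  by ring.
pose s (t : R^o) : dsum (ideal_mod idI) (ideal_mod idJ) := (t : R) *: (g k, b').
have sl : linear s by move=> t u v; rewrite /s scalerDl scalerA.
have sf : cancel (linear_of sl) (linear_of Phil).
  move=> t; rewrite [linear_of sl t]/(t *: (g k, b')) linearZ.
  suff e1 : ga * c + \sum_i be i * (phi i b' : R) = 1.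
    exact: etrans (congr1 ( *%R (t : R)) e1) (mulr1 t).
  rewrite -phi1 /ga mulr_suml -big_split; apply: eq_bigr => i _ /=.
  rewrite [in RHS]hab linearP linearZ /= /GRing.scale /=; ring.
have [L eL] := split_mod_iso sf.
by exists L.
Qed.

End Splitting.

(** * Cancelling free summands *)

Section Cancellation.
Variables (R : comNzRingType) (n : nat).
Implicit Types (I J : set R).

Definition free_plus I (idI : ideal I) : lmodType R :=
  dsum ('rV[R]_n : lmodType R) (ideal_mod idI).

Definition elt I (idI : ideal I) (x : ideal_mod idI) : R := submod_incl x.

Lemma eltD I (idI : ideal I) a (x y : ideal_mod idI) : elt (a *: x + y) = a * elt x + elt y.
Proof. by []. Qed.

Lemma elt_inj I (idI : ideal I) : injective (@elt I idI).
Proof. exact: submod_incl_inj. Qed.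

Section Coordinates.
Variables (I : set R) (idI : ideal I).

Definition coords (p : free_plus idI) : 'rV[R]_n.+1 :=
  \row_j if unlift ord0 j is Some k then p.1 0 k else elt p.2.

(** For regular x this becomes a basis once x is inverted; over R only the multiple x p of a vector
    p is expressed through it, see [frameP]. *)
Definition frame (x : ideal_mod idI) (i : 'I_n.+1) : free_plus idI :=
  if unlift ord0 i is Some k then (delta_mx 0 k, 0) else (0, x).

Lemma coords_linear : linear coords.
Proof.
move=> a p q; apply/rowP => j; rewrite !mxE; case: unliftP => [k|] _; last exact: eltD.
have -> : (a *: p + q).1 = a *: p.1 + q.1 by [].
by rewrite !mxE.
Qed.

HB.instance Definition _ := GRing.isLinear.Build R (free_plus idI) _ _ coords coords_linear.

Lemma frameP x (p : free_plus idI) : elt x *: p =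
  elt p.2 *: frame x ord0 +
  elt x *: \sum_k p.1 0 k *: frame x (lift ord0 k).
Proof.
case: p => v y /=; rewrite /frame unlift_none.
rewrite (eq_bigr (fun k => (v 0 k *: delta_mx 0 k, 0) : free_plus idI)); last first.
  by move=> k _; rewrite liftK; congr pair; rewrite scaler0.
rewrite sum_pair -row_sum_delta big1_eq; congr pair; rewrite /= ?scaler0 ?add0r //.
by rewrite addr0; apply: elt_inj; rewrite [LHS]mulrC.
Qed.

End Coordinates.

Section Determinant.
Variables (I J : set R) (idI : ideal I) (idJ : ideal J).
Variable f : {linear free_plus idI -> free_plus idJ}.

Definition frame_mx (x : ideal_mod idI) : 'M[R]_n.+1 :=
  \matrix_i coords (f (frame x i)).

(** Column 0 holds the components in J, so expansion along it stays in J. *)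
Lemma det_frame_mx_in x : J (\det (frame_mx x)).
Proof.
rewrite (expand_det_col _ ord0); apply: ideal_sum => // i; apply: ideal_mulr => //.
by rewrite !mxE unlift_none; exact: (submod_inclP (f (frame x i)).2).
Qed.

(** The element x enters row 0 only. *)
Lemma det_frame_mx_linear a x y :
  \det (frame_mx (a *: x + y)) = a * \det (frame_mx x) + \det (frame_mx y).
Proof.
rewrite -[X in _ = _ + X]mul1r; apply: (determinant_multilinear (i0 := ord0)).
- rewrite scale1r !rowK /frame unlift_none -coords_linear -linearP; congr (coords (f _)).
  by congr pair; rewrite /= scaler0 addr0.
- by apply/matrixP => i j; rewrite !mxE /frame liftK.
- by apply/matrixP => i j; rewrite !mxE /frame liftK.
Qed.

(** This is the top exterior power of f, with the top exterior power of R^n + I identified with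
    I. *)
Definition det_map (x : ideal_mod idI) : ideal_mod idJ :=
  submod_of (ideal_submodule idJ) (det_frame_mx_in x).

Lemma det_map_linear : linear det_map.
Proof. by move=> a x y; apply: elt_inj; exact: det_frame_mx_linear. Qed.

(** Both sides are the determinant at the frame vector x y, so [det_map] acts as a fraction det(x) /
    x independent of a regular x. *)
Lemma det_mapE x y :
  elt x * elt (det_map y) = elt y * \det (frame_mx x) :> R.
Proof.
have detZ a z : \det (frame_mx (a *: z)) = a * \det (frame_mx z).
  have d0 : \det (frame_mx 0) = 0.
    by have := det_frame_mx_linear (-1) 0 0; rewrite scaler0 addr0 mulN1r addNr.
  by have := det_frame_mx_linear a z 0; rewrite d0 !addr0.
change (elt x * \det (frame_mx y) = elt y * \det (frame_mx x)).
rewrite -!detZ; congr (\det (frame_mx _)).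
by apply: elt_inj; exact: mulrC.
Qed.

End Determinant.

Section Composition.
Variables (I J : set R) (idI : ideal I) (idJ : ideal J).
Variables (f : {linear free_plus idI -> free_plus idJ}).
Variables (g : {linear free_plus idJ -> free_plus idI}).
Hypothesis fK : cancel f g.
Variables (a : ideal_mod idI) (b : ideal_mod idJ).
Hypotheses (areg : GRing.lreg (elt a)).
Hypotheses (breg : GRing.lreg (elt b)).

(** Multiplicativity of the determinant, with the denominators of the two frames cleared. *)
Lemma det_frame_mx_mul :
  \det (frame_mx f a) * \det (frame_mx g b) = elt a * elt b.
Proof.
pose D : 'M[R]_n.+1 := diag_mx (\row_j if j == ord0 then 1 else elt b).
pose D' : 'M[R]_n.+1 := diag_mx (\row_j if j == ord0 then elt a else 1).
have e : frame_mx f a *m D *m frame_mx g b = elt b *: D'.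
  apply/row_matrixP => i; rewrite !row_mul rowK.
  have -> (p : free_plus idJ) : coords p *m D *m frame_mx g b =
      elt b *: coords (g p).
    have -> : elt b *: coords (g p) = elt p.2 *: coords (g (frame b ord0)) +
        elt b *: \sum_k p.1 0 k *: coords (g (frame b (lift ord0 k))).
      have cgZ t q : coords (g (t *: q)) = t *: coords (g q).
        by rewrite [g _]linearZ [LHS]linearZ.
      have cgS q (F : 'I_n -> free_plus idJ) :
          coords (g (q + \sum_k F k)) = coords (g q) + \sum_k coords (g (F k)).
        by rewrite [g _]linearD [LHS]linearD; congr (_ + _); rewrite !linear_sum.
      rewrite -cgZ frameP scaler_sumr cgS cgZ scaler_sumr.
      by congr (_ + _); apply: eq_bigr => k _; rewrite !cgZ.
    rewrite mulmx_sum_row big_ord_recl; congr (_ + _).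
      by rewrite rowK mul_mx_diag !mxE eqxx unlift_none mulr1.
    rewrite scaler_sumr; apply: eq_bigr => k _.
    by rewrite rowK mul_mx_diag !mxE liftK scalerA; congr (_ *: _); exact: mulrC.
  rewrite fK; apply/rowP => j; rewrite !mxE /frame.
  case: unliftP => [k|] ->; case: unliftP => [l|] ->; rewrite ?mxE; congr (_ * _).
  by rewrite eqxx (inj_eq lift_inj) eq_sym.
have := congr1 determinant e; rewrite detZ !det_mulmx !det_diag.
rewrite big_ord_recl [X in _ = _ * X]big_ord_recl !mxE eqxx.
rewrite (eq_bigr (fun=> elt b)); last by move=> i _; rewrite mxE.
rewrite [X in _ = _ * (_ * X)]big1; last by move=> i _; rewrite mxE.
rewrite prodr_const card_ord => e'.
have bn : GRing.lreg (elt b ^+ n) by exact: GRing.lregX.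
apply: bn; rewrite mulr1 mul1r in e'; rewrite mulrCA mulrA e' exprS; ring.
Qed.

Lemma det_mapK : cancel (det_map f) (det_map g).
Proof.
move=> x; apply: elt_inj.
apply: areg; apply: breg.
rewrite /= [LHS]mulrCA (det_mapE g b) [LHS]mulrA (det_mapE f a).
by rewrite -[LHS]mulrA det_frame_mx_mul mulrC -mulrA mulrCA.
Qed.

End Composition.

(* The determinant of an isomorphism R^n + I -> R^n + J carries I onto J. *)
Lemma free_plus_cancel I J (idI : ideal I) (idJ : ideal J) :
  regular_ideal I -> regular_ideal J ->
  mod_iso (free_plus idI) (free_plus idJ) -> mod_iso (ideal_mod idI) (ideal_mod idJ).
Proof.
move=> [a Ia areg] [b Jb breg] /mod_isoP[f [g [fg gf]]].
pose a' : ideal_mod idI := submod_of (ideal_submodule idI) (Ia : (I : set R^o) a).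
pose b' : ideal_mod idJ := submod_of (ideal_submodule idJ) (Jb : (J : set R^o) b).
exists (linear_of (det_map_linear f)), (det_map g).
  exact: (det_mapK fg (a := a') (b := b')).
exact: (det_mapK gf (a := b') (b := a')).
Qed.

End Cancellation.

(** * The rank of a projective module *)

Section Rank.
Variables (R : comNzRingType) (K : fieldType) (f : {rmorphism R -> K}).
Implicit Types (e : idem R) (I : set R).

(** The dimension over K of the module after base change along f. *)
Definition idem_rank e : nat := \rank (map_mx f (idem_mx e)).

Definition idem_row e (i : 'I_(idem_size e)) : idem_im e :=
  submod_of (idem_im_submodule e)
    ((etrans (esym (row_mul i _ _)) (congr1 _ (idemP e))) : [set v | v *m idem_mx e = v] _).

Lemma idem_im_sum e (v : idem_im e) :
  v = \sum_i (submod_incl v : 'rV_(idem_size e)) 0 i *: idem_row i.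
Proof.
apply: submod_incl_inj; rewrite linear_sum -[LHS](submod_inclP v) /=.
by rewrite mulmx_sum_row; apply: eq_bigr.
Qed.

(** Writing the isomorphism and its inverse on rows gives E = A E' B, and products over K do not
    increase the rank. *)
Lemma idem_rank_le e e' : mod_iso (idem_im e) (idem_im e') ->
  (idem_rank e <= idem_rank e')%N.
Proof.
move=> /mod_isoP[h [g [hg _]]].
pose A := \matrix_i (submod_incl (h (idem_row i)) : 'rV_(idem_size e')).
pose B := \matrix_i (submod_incl (g (idem_row i)) : 'rV_(idem_size e)).
have AE : A *m idem_mx e' = A.
  apply/row_matrixP => i; rewrite row_mul !rowK.
  exact: (submod_inclP (h (idem_row i))).
suff EAB : idem_mx e = A *m idem_mx e' *m B.
  rewrite /idem_rank [in X in (X <= _)%N]EAB !map_mxM /=.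
  apply: leq_trans (mxrankM_maxl _ _) _.
  exact: mxrankM_maxr.
rewrite AE; apply/row_matrixP => i; rewrite row_mul rowK mulmx_sum_row.
have -> : row i (idem_mx e) = submod_incl (g (h (idem_row i))) by rewrite hg.
rewrite {1}[h _]idem_im_sum !linear_sum; apply: eq_bigr => j _.
by rewrite rowK !linearZ.
Qed.

Lemma idem_rank_iso e e' : mod_iso (idem_im e) (idem_im e') ->
  idem_rank e = idem_rank e'.
Proof.
move=> ee'; apply/eqP; rewrite eqn_leq idem_rank_le //=.
by apply: idem_rank_le; exact: mod_iso_sym.
Qed.

Lemma block_diag_idem m n (A : 'M[R]_m) (B : 'M[R]_n) : A *m A = A -> B *m B = B ->
  block_mx A 0 0 B *m block_mx A 0 0 B = block_mx A 0 0 B.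
Proof.
by move=> AA BB; rewrite mulmx_block !mul0mx !mulmx0 AA BB !addr0 add0r.
Qed.

Definition idem_dsum e e' : idem R := Idem (block_diag_idem (idemP e) (idemP e')).

Lemma idem_dsumP e e' :
  mod_iso (idem_im (idem_dsum e e')) (dsum (idem_im e) (idem_im e')).
Proof.
have pairP (v : 'rV_(idem_size e)) (w : 'rV_(idem_size e')) :
    row_mx v w *m block_mx (idem_mx e) 0 0 (idem_mx e') =
    row_mx (v *m idem_mx e) (w *m idem_mx e').
  by rewrite mul_row_block !mulmx0 addr0 add0r.
have lP (u : idem_im (idem_dsum e e')) :
    lsubmx (submod_incl u : 'rV_(_ + _)) *m idem_mx e = lsubmx (submod_incl u : 'rV_(_ + _)).
  have := submod_inclP u; rewrite /= -{1}[submod_incl u]hsubmxK pairP => e1.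
  by rewrite -[in RHS]e1 row_mxKl.
have rP (u : idem_im (idem_dsum e e')) :
    rsubmx (submod_incl u : 'rV_(_ + _)) *m idem_mx e' = rsubmx (submod_incl u : 'rV_(_ + _)).
  have := submod_inclP u; rewrite /= -{1}[submod_incl u]hsubmxK pairP => e1.
  by rewrite -[in RHS]e1 row_mxKr.
pose h u : dsum (idem_im e) (idem_im e') :=
  (submod_of (idem_im_submodule e) (lP u : [set v | v *m idem_mx e = v] _),
   submod_of (idem_im_submodule e') (rP u : [set v | v *m idem_mx e' = v] _)).
have hl : linear h.
  by move=> a u v; congr pair; apply: submod_incl_inj; rewrite [RHS]linearP;
    apply/rowP => i; rewrite !mxE.
have gP (p : dsum (idem_im e) (idem_im e')) :
    [set v | v *m idem_mx (idem_dsum e e') = v] (row_mx (submod_incl p.1) (submod_incl p.2)).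
  by rewrite /= pairP (submod_inclP p.1) (submod_inclP p.2).
exists (linear_of hl), (fun p => submod_of (idem_im_submodule _) (gP p)).
  by move=> u; apply: submod_incl_inj; rewrite -[RHS](@hsubmxK R 1).
by move=> [u v]; congr pair; apply: submod_incl_inj;
  rewrite /submod_incl /= ?row_mxKl ?row_mxKr.
Qed.

Lemma idem_rank_dsum e e' : idem_rank (idem_dsum e e') = (idem_rank e + idem_rank e')%N.
Proof.
by rewrite /idem_rank /= map_block_mx !map_mx0 rank_diag_block_mx.
Qed.

(* Functionals on an ideal satisfy phi(x) y = phi(y) x, so the 2-minors vanish. *)
Lemma idem_rank_ideal_le1 I (idI : ideal I) e :
  mod_iso (idem_im e) (ideal_mod idI) -> (idem_rank e <= 1)%N.
Proof.
move=> /mod_isoP[h [g [hg _]]].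
have sw v w : elt (h w) *: v = elt (h v) *: w.
  by apply: (can_inj hg); apply: elt_inj; rewrite !linearZ; exact: mulrC.
have swap (phi : {linear idem_im e -> R^o}) v w : (phi v : R) *: w = (phi w : R) *: v.
  apply: (can_inj hg); apply: elt_inj; rewrite !linearZ.
  transitivity (phi (elt (h w) *: v) : R); first by rewrite linearZ [LHS]mulrC.
  by rewrite sw linearZ [LHS]mulrC.
have coordl j : linear (fun v : idem_im e => (submod_incl v : 'rV_(idem_size e)) 0 j : R^o).
  by move=> a v w; rewrite linearP !mxE.
have minor i j k l : idem_mx e i j * idem_mx e k l = idem_mx e i l * idem_mx e k j.
  have /(congr1 (fun v => (submod_incl v : 'rV_(idem_size e)) 0 l)) :=
    swap (linear_of (coordl j)) (idem_row i) (idem_row k).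
  by rewrite /= !mxE => ->; exact: mulrC.
rewrite /idem_rank; set E := map_mx f _.
have [->|/matrix0Pn[k [l Ekl]]] := eqVneq E 0; first by rewrite mxrank0.
(* With all 2-minors zero, a nonzero entry exhibits E as a column times a row. *)
have -> : E = ((E k l)^-1 *: col l E) *m row k E.
  apply/matrixP => i j; rewrite [RHS]mxE big_ord1 !mxE.
  rewrite -mulrA -rmorphM -minor rmorphM mulrCA mulVf ?mulr1 //.
  by rewrite mxE in Ekl.
apply: leq_trans (mxrankM_maxl _ _) _; exact: rank_leq_col.
Qed.

(** Each v in the image equals v E, so its coordinates vanish in K as soon as E does. *)
Lemma idem_rank_eq0 e : idem_rank e = 0%N ->
  forall (phi : {linear idem_im e -> R^o}) v, f (phi v) = 0.
Proof.
move=> /eqP; rewrite mxrank_eq0 => /eqP E0 phi v; rewrite [v]idem_im_sum linear_sum.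
rewrite rmorph_sum big1 // => i _; rewrite linearZ rmorphM /=.
have -> : (submod_incl v : 'rV_(idem_size e)) 0 i =
    ((submod_incl v : 'rV_(idem_size e)) *m idem_mx e) 0 i.
  by congr (fun_of_matrix _ _ _); exact: esym (submod_inclP v).
rewrite mxE rmorph_sum big1 ?mul0r // => j _; rewrite rmorphM.
have /matrixP/(_ j i) := E0; rewrite !mxE => ->; exact: mulr0.
Qed.

(** Rank zero would turn the trace relation sum psi_i(g_i) = 1 into 0 = 1 in K. *)
Lemma idem_rank_ideal I (idI : ideal I) e : invertible_ideal I ->
  mod_iso (idem_im e) (ideal_mod idI) -> idem_rank e = 1%N.
Proof.
move=> /invertible_inverse_basis[d [n [x [r Ib]]]] eI.
apply/eqP; rewrite eqn_leq (idem_rank_ideal_le1 eI) lt0n; apply/eqP => /idem_rank_eq0 r0.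
have [g [psi [_ _ _ psi1]]] := inverse_basis_mod idI Ib.
have [h [k [_ kh]]] := mod_isoP eI.
suff : f 1 = 0 by rewrite rmorph1 => /eqP; rewrite oner_eq0.
rewrite -psi1 rmorph_sum big1 // => i _.
by rewrite -[g i]kh; exact: (r0 (psi i \o h)%FUN).
Qed.

End Rank.

(** * The monoid of finitely generated projective modules *)

Section Classes.
Variable R : comNzRingType.
Implicit Types (M N : lmodType R) (I J : set R).

Local Notation V := (class_monoid (proj_class R)).

Definition cls M (PM : fg_projective M) : V := @iso_class R (proj_class R) M PM.

Lemma clsP M N (PM : fg_projective M) (PN : fg_projective N) :
  cls PM = cls PN <-> mod_iso M N.
Proof. exact: (@iso_classP R (proj_class R)). Qed.

Lemma cls_surj (x : V) : exists M (PM : fg_projective M), x = cls PM.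
Proof. exact: (@iso_class_surj R (proj_class R)). Qed.

Lemma fg_projective_dsum M N :
  fg_projective M -> fg_projective N -> fg_projective (dsum M N).
Proof. by move=> [fM pM] [fN pN]; split; [exact: fin_gen_dsum|exact: projective_dsum]. Qed.

Lemma fg_projective_zero : fg_projective (zero_module R).
Proof. by split; [exact: fin_gen_zero|exact: projective_zero]. Qed.

Lemma fg_projective_iso M N : mod_iso M N -> fg_projective M -> fg_projective N.
Proof. by move=> MN [fM pM]; split; [exact: fin_gen_iso fM|exact: projective_iso pM]. Qed.

Lemma fg_projective_summand M N : fg_projective (dsum M N) ->
  fg_projective M /\ fg_projective N.
Proof.
have summ (A B : lmodType R) : fg_projective (dsum A B) -> fg_projective A.
  by move=> [fAB pAB]; split; [exact: fin_gen_summand fAB|exact: projective_summand pAB].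
move=> PMN; split; first exact: summ PMN.
exact: (summ N M (fg_projective_iso (dsum_isoC M N) PMN)).
Qed.

Lemma cls_dsum M N (PM : fg_projective M) (PN : fg_projective N)
    (PMN : fg_projective (dsum M N)) : cls PMN = cls PM + cls PN.
Proof. by rewrite /cls class_monoidD; apply/clsP; exact: mod_iso_refl. Qed.

Lemma cls_zero (P0 : fg_projective (zero_module R)) : cls P0 = 0.
Proof. by apply/(clsP P0); exact: mod_iso_refl. Qed.

Lemma cls_iso_dsum M N P (PP : fg_projective P) : mod_iso P (dsum M N) ->
  exists (PM : fg_projective M) (PN : fg_projective N), cls PP = cls PM + cls PN.
Proof.
move=> e; have PMN := fg_projective_iso e PP.
have [PM PN] := fg_projective_summand PMN; exists PM, PN.
by rewrite -(cls_dsum PM PN PMN); exact/clsP.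
Qed.

Lemma fg_projective_free1 : fg_projective (R^o : lmodType R).
Proof.
have db : dual_basis (R^o : lmodType R).
  exists 1%N, (fun=> 1), (fun=> idfun) => x.
  by rewrite big_ord1; exact: (esym (mulr1 _)).
by split; [exact: dual_basis_fin_gen|exact: dual_basis_projective].
Qed.

Definition cls1 : V := cls fg_projective_free1.

Lemma row_succ_iso n :
  mod_iso ('rV[R]_n.+1 : lmodType R) (dsum (R^o : lmodType R) ('rV[R]_n : lmodType R)).
Proof.
pose h (v : 'rV[R]_n.+1) : dsum (R^o : lmodType R) ('rV[R]_n : lmodType R) :=
  (v 0 ord0, \row_j v 0 (lift ord0 j)).
have hl : linear h.
  move=> a u v; congr pair; first by rewrite !mxE.
  by apply/rowP => j; rewrite !mxE.
pose g (p : dsum (R^o : lmodType R) ('rV[R]_n : lmodType R)) : 'rV[R]_n.+1 :=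
  \row_j if unlift ord0 j is Some k then (p.2 : 'rV[R]_n) 0 k else p.1.
exists (linear_of hl), g.
  by move=> v; apply/rowP => j; rewrite mxE; case: unliftP => [k|] -> //=; rewrite mxE.
move=> [a v]; congr pair; first by rewrite mxE unlift_none.
by apply/rowP => j; rewrite !mxE liftK.
Qed.

Lemma cls_free n : exists P : fg_projective ('rV[R]_n : lmodType R), cls P = cls1 *+ n.
Proof.
elim: n => [|n [P eP]].
  have P0 := fg_projective_zero.
  by exists P0; exact: cls_zero.
have Pd := fg_projective_dsum fg_projective_free1 P.
have P' := fg_projective_iso (mod_iso_sym (row_succ_iso n)) Pd.
exists P'; rewrite mulrS -eP -(cls_dsum fg_projective_free1 P Pd).
by apply/clsP; exact: row_succ_iso.
Qed.

(** The image of an idempotent matrix is a summand of R^n. This is the source of inverses for the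
    rank one classes. *)
Lemma cls_dvd_free (x : V) : exists y n, x + y = cls1 *+ n.
Proof.
have [M [PM ->]] := cls_surj x; have [e Me] := fg_projective_idem PM.
pose n := idem_size e.
have pP (v : 'rV[R]_n) : [set v | v *m idem_mx e = v] (v *m idem_mx e).
  by rewrite /= -mulmxA (idemP e).
pose p (v : 'rV[R]_n) : idem_im e := submod_of (idem_im_submodule e) (pP v).
have pl : linear p.
  move=> a u v; apply: submod_incl_inj; rewrite [RHS]linearP.
  by rewrite /submod_incl /= mulmxDl scalemxAl.
have pK : cancel (@submod_incl _ _ _ (idem_im_submodule e)) (linear_of pl).
  move=> v; apply: (@submod_incl_inj R _ _ (idem_im_submodule e)).
  exact: (submod_inclP v).
have [K eK] := split_mod_iso pK.
have [PF eF] := cls_free n.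
have [PI [PK e1]] := cls_iso_dsum PF eK.
exists (cls PK), n; rewrite -eF e1; congr (_ + _); exact/clsP.
Qed.

Definition ideal_cls (x : V) := exists I (idI : ideal I) (PI : fg_projective (ideal_mod idI)),
  invertible_ideal I /\ x = cls PI.

Lemma invertible_regular_ideal I : invertible_ideal I -> regular_ideal I.
Proof.
move=> invI; have [idI _] := invI.
have [d [n [x [r Ib]]]] := invertible_inverse_basis invI.
by exists d; [exact: regular_inverse_basis Ib|case: Ib].
Qed.

Lemma ideal_cls_cancel n (x y : V) : ideal_cls x -> ideal_cls y ->
  cls1 *+ n + x = cls1 *+ n + y -> x = y.
Proof.
move=> [I [idI [PI [invI ->]]]] [J [idJ [PJ [invJ ->]]]].
have [PF <-] := cls_free n.
rewrite -(cls_dsum PF PI (fg_projective_dsum PF PI)).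
rewrite -(cls_dsum PF PJ (fg_projective_dsum PF PJ)) => /clsP e.
by apply/clsP; apply: free_plus_cancel e; exact: invertible_regular_ideal.
Qed.

Section Rank.
Variables (K : fieldType) (f : {rmorphism R -> K}).
Hypotheses (prufer : prufer_ring R) (half : one_half_generator R).
Hypothesis small : small_zero_divisors R.

(** The representatives in [proj_class] are idempotent matrices, so [repr x] is one. *)
Definition cls_rank (x : V) : nat := idem_rank f (repr x).

Lemma cls_rankE M (PM : fg_projective M) (e : idem R) :
  mod_iso M (idem_im e) -> cls_rank (cls PM) = idem_rank f e.
Proof.
move=> Me; apply: idem_rank_iso; apply: mod_iso_trans Me.
apply/(@iso_classP R (proj_class R) _ _ (@class_repP R (proj_class R) (cls PM)) PM).
exact: iso_class_rep.
Qed.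

Lemma cls_rankD (x y : V) : cls_rank (x + y) = (cls_rank x + cls_rank y)%N.
Proof.
have [M [PM ->]] := cls_surj x; have [N [PN ->]] := cls_surj y.
have [e Me] := fg_projective_idem PM; have [e' Ne] := fg_projective_idem PN.
have PMN := fg_projective_dsum PM PN.
rewrite -(cls_dsum PM PN PMN) (cls_rankE _ Me) (cls_rankE _ Ne) -idem_rank_dsum.
apply: cls_rankE; apply: mod_iso_trans (mod_iso_dsum Me Ne) _.
by apply: mod_iso_sym; exact: idem_dsumP.
Qed.

Lemma cls_rank_ideal x : ideal_cls x -> cls_rank x = 1%N.
Proof.
move=> [I [idI [PI [invI ->]]]]; have [e Ie] := fg_projective_idem PI.
by rewrite (cls_rankE _ Ie); apply: idem_rank_ideal (mod_iso_sym Ie).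
Qed.

Lemma cls_split x : x <> 0 -> exists y z, ideal_cls y /\ x = y + z.
Proof.
have [M [PM ->]] := cls_surj x => M0.
have [|I [idI [N [invI e]]]] := fg_projective_split prufer small PM.
  move=> e; apply: M0; have P0 := fg_projective_iso e PM.
  by rewrite -(cls_zero P0); apply/clsP.
have [PI [PN ->]] := cls_iso_dsum PM e.
by exists (cls PI), (cls PN); split=> //; exists I, idI, PI.
Qed.

(** A nonzero class splits off an ideal, which already contributes one to the rank. *)
Lemma cls_rank_eq0 x : cls_rank x = 0%N -> x = 0.
Proof.
move=> x0; apply: contrapT => /cls_split[y [z [Iy e]]].
by move: x0; rewrite e cls_rankD cls_rank_ideal.
Qed.

Lemma cls_rank0 : cls_rank 0 = 0%N.
Proof. by have := cls_rankD 0 0; rewrite addr0; lia. Qed.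

Lemma cls_rank_eq1 x : cls_rank x = 1%N <-> ideal_cls x.
Proof.
split=> [x1|]; last exact: cls_rank_ideal.
have [|y [z [Iy e]]] := @cls_split x; first by move=> x0; rewrite x0 cls_rank0 in x1.
have z0 : z = 0.
  by apply: cls_rank_eq0; move: x1; rewrite e cls_rankD cls_rank_ideal //; lia.
by rewrite e z0 addr0.
Qed.

Lemma cls_rank_cls1 : cls_rank cls1 = 1%N.
Proof.
have e1 : (1%:M : 'M[R]_1) *m 1%:M = 1%:M by rewrite mul1mx.
have h : mod_iso (R^o : lmodType R) (idem_im (Idem e1)).
  have sP (t : R^o) : [set v | v *m idem_mx (Idem e1) = v] (t%:M : 'rV[R]_1).
    by rewrite /= mulmx1.
  pose s (t : R^o) : idem_im (Idem e1) := submod_of (idem_im_submodule (Idem e1)) (sP t).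
  have sl : linear s.
    move=> a t u; apply: submod_incl_inj; rewrite [RHS]linearP; apply/rowP => j.
    by rewrite !mxE !ord1 eqxx !mulr1n.
  exists (linear_of sl), (fun v => (submod_incl v : 'rV[R]_1) 0 0).
    by move=> t; rewrite /submod_incl /= mxE eqxx mulr1n.
  move=> v; apply: submod_incl_inj; apply/rowP => j.
  by rewrite ord1 /submod_incl /= mxE eqxx mulr1n.
by rewrite (cls_rankE _ h) /idem_rank /= map_mx1 mxrank1.
Qed.

(** Rank at least two leaves a nonzero rest after one ideal is split off, hence a second ideal; the
    sum of the two contains R. *)
Lemma cls_rank_ge2 x : (2 <= cls_rank x)%N -> exists y, x = cls1 + y.
Proof.
move=> x2; have [|y [z [Iy e]]] := @cls_split x.
  by move=> x0; move: x2; rewrite x0 cls_rank0.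
have [|y' [z' [Iy' e']]] := @cls_split z.
  by move=> z0; move: x2; rewrite e z0 addr0 cls_rank_ideal.
move: Iy Iy' => [I [idI [PI [invI ey]]]] [J [idJ [PJ [invJ ey']]]].
have [L eL] := invertible_dsum_split idI idJ half small invI invJ.
have PIJ := fg_projective_dsum PI PJ.
have [P1 [PL e1]] := cls_iso_dsum PIJ eL.
exists (cls PL + z'); rewrite e e' ey ey' addrA -(cls_dsum PI PJ PIJ) e1 addrA.
by congr (_ + _ + _); apply/clsP; exact: mod_iso_refl.
Qed.

Lemma cls_rankS n x : cls_rank x = n.+1 -> exists2 y, ideal_cls y & x = cls1 *+ n + y.
Proof.
elim: n x => [x /cls_rank_eq1 x1|n IH x xn]; first by exists x; rewrite ?add0r.
have [|y e] := @cls_rank_ge2 x; first by rewrite xn.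
have [|z Iz ez] := IH y; first by move: xn; rewrite e cls_rankD cls_rank_cls1; lia.
by exists z; rewrite // e ez addrA mulrS.
Qed.

(** Equal ranks bring both sides to a free module of the same size plus an ideal, where determinants
    apply. *)
Lemma cls1_cancel x y : cls1 + x = cls1 + y -> x = y.
Proof.
move=> e; have er : cls_rank x = cls_rank y.
  by have := congr1 cls_rank e; rewrite !cls_rankD; lia.
case En : (cls_rank x) er => [|n] er.
  by rewrite (cls_rank_eq0 En) (cls_rank_eq0 (esym er)).
have [x' Ix ex] := cls_rankS En; have [y' Iy ey] := cls_rankS (esym er).
rewrite ex ey in e *; congr (_ + _); apply: (@ideal_cls_cancel n.+1) => //.
by rewrite mulrS -!addrA.
Qed.

End Rank.
End Classes.

(** * Monoids with a rank *)

(** The shape of {0} together with pairs of a positive rank and an element of an abelian group,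
    described without the group: p is its identity, and [dvd_base] supplies inverses. It is
    instantiated by V and by its reduced monoid. *)
Record ranked_monoid (H : nmodType) (rk : H -> nat) (p : H) : Prop := RankedMonoid {
  rankD : forall x y, rk (x + y) = (rk x + rk y)%N;
  rank_eq0 : forall x, rk x = 0%N -> x = 0;
  rank_base : rk p = 1%N;
  rank_ge2 : forall x, (2 <= rk x)%N -> exists y, x = p + y;
  base_cancel : forall x y, p + x = p + y -> x = y;
  dvd_base : forall x, exists y n, x + y = p *+ n }.

Section RankedMonoid.
Variables (H : nmodType) (rk : H -> nat) (p : H).
Hypothesis rH : ranked_monoid rk p.
Implicit Types a b : H.

Lemma rank0 : rk 0 = 0%N.
Proof. by have := rankD rH 0 0; rewrite addr0; lia. Qed.

Lemma rank_sum I (s : seq I) (F : I -> H) :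
  rk (\sum_(i <- s) F i) = (\sum_(i <- s) rk (F i))%N.
Proof. exact: (big_morph rk (rankD rH) rank0). Qed.

Lemma rankMn x n : rk (x *+ n) = (n * rk x)%N.
Proof. by elim: n => [|n IH]; rewrite ?mulr0n ?rank0 // mulrS (rankD rH) IH mulSn. Qed.

Lemma base_cancelMn n x y : p *+ n + x = p *+ n + y -> x = y.
Proof.
elim: n => [|n IH]; first by rewrite !add0r.
by rewrite mulrS -!addrA => /(base_cancel rH).
Qed.

(** Adding a cofactor turns a into a multiple of p, which cancels. *)
Lemma ranked_cancellative : cancellative H.
Proof.
move=> a b c e; have [a' [n aa']] := dvd_base rH a.
by apply: (@base_cancelMn n); rewrite -aa' [a + a']addrC -!addrA e.
Qed.

Lemma ranked_unit a : mon_unit a <-> a = 0.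
Proof.
split=> [[b ab]|->]; last by exists 0; rewrite addr0.
by apply: (rank_eq0 rH); have := rankD rH a b; rewrite ab rank0; lia.
Qed.

Lemma ranked_nonunit a : ~ mon_unit a <-> (0 < rk a)%N.
Proof.
split=> [a0|a0 /ranked_unit e]; last by rewrite e rank0 in a0.
by rewrite lt0n; apply/eqP => /(rank_eq0 rH)/ranked_unit.
Qed.

Lemma ranked_atom a : mon_atom a <-> rk a = 1%N.
Proof.
split=> [[/ranked_nonunit a0 aP]|a1]; last first.
  split=> [|b c e]; first by apply/ranked_nonunit; rewrite a1.
  have := rankD rH b c; rewrite -e a1 => bc.
  by case Eb : (rk b) bc => [|[|k]] bc; [left|right|lia];
    apply/ranked_unit; apply: (rank_eq0 rH) => //; lia.
have [a2|] := ltnP 1 (rk a); last by lia.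
have [y e] := rank_ge2 rH a2; have ry := rankD rH p y.
rewrite -e (rank_base rH) in ry.
by have [/ranked_unit p0|/ranked_unit y0] := aP _ _ e;
  [have := rank_base rH; rewrite p0 rank0|rewrite y0 rank0 in ry; lia].
Qed.

Lemma rank_succ n x : rk x = n.+1 -> exists2 y, rk y = 1%N & x = p *+ n + y.
Proof.
elim: n x => [x x1|n IH x xn]; first by exists x; rewrite ?add0r.
have [|y e] := rank_ge2 rH (x := x); first by rewrite xn.
have := rankD rH p y; rewrite -e xn (rank_base rH) => yn.
have [|z z1 ez] := IH y; first by lia.
by exists z; rewrite // e ez addrA mulrS.
Qed.

(** Inversion in the group of rank one elements with identity p: strip a cofactor of x in a multiple
    of p of its copies of p. A cofactor of rank zero means x = p. *)
Lemma rank1_inverse x : rk x = 1%N -> exists2 y, rk y = 1%N & x + y = p + p.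
Proof.
move=> x1; have [z [n e]] := dvd_base rH x.
have := congr1 rk e; rewrite (rankD rH) rankMn x1 (rank_base rH) muln1.
case Ez : (rk z) => [|m] en.
  rewrite -en (rank_eq0 rH Ez) addr0 mulr1n in e.
  by exists p; rewrite ?e ?(rank_base rH).
have [y y1 ez] := rank_succ Ez; exists y => //.
apply: (@base_cancelMn m).
by rewrite addrCA -ez e -en add1n !mulrS [RHS]addrC -addrA.
Qed.

(** With u + u' = p + p, the element x + u' has rank at least three and so contains p + p; cancel
    u'. Hence any atom divides any sum of two atoms. *)
Lemma rank1_dvd u x : rk u = 1%N -> (2 <= rk x)%N -> exists y, x = u + y.
Proof.
move=> u1 x2; have [u' u'1 uu'] := rank1_inverse u1.
have [|y e] := rank_ge2 rH (x := x + u'); first by rewrite (rankD rH); lia.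
have := rankD rH p y; rewrite -e (rankD rH) u'1 (rank_base rH) => ry.
have [|z ez] := rank_ge2 rH (x := y); first by lia.
exists z; apply: (@ranked_cancellative u').
by rewrite addrC e ez addrA -uu' addrCA addrA.
Qed.

Lemma rank1_sum x : exists s : seq H, (forall u, u \in s -> rk u = 1%N) /\ \sum_(u <- s) u = x.
Proof.
case Ex : (rk x) => [|n].
  by exists [::]; split=> //; rewrite big_nil (rank_eq0 rH Ex).
have [y y1 ->] := rank_succ Ex; exists (y :: nseq n p); split=> [u|].
  by rewrite inE mem_nseq => /orP[/eqP->//|/andP[_ /eqP->]]; exact: rank_base.
by rewrite big_cons big_nseq iter_addr_0 addrC.
Qed.

Lemma ranked_atomic : atomic H.
Proof.
move=> a _; have [s [s1 <-]] := rank1_sum a.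
exists (size s), (fun i => nth 0 s i); split=> [i|].
  by apply/ranked_atom; apply: s1; exact: mem_nth.
by rewrite (big_nth 0) big_mkord.
Qed.

(** An element of rank one written in generators must itself be a generator, by additivity of the
    rank; conversely the elements of rank one generate H. *)
Lemma ranked_fin_gen : fin_gen_monoid H <-> finite_set [set x | rk x = 1%N].
Proof.
split=> [[n [g gP]]|/finite_seqP[s sE]].
  apply: (@sub_finite_set _ _ (range g)); last exact: finite_image.
  move=> a /= a1; have [k e] := gP a.
  have [i ri] : exists i, rk (g i *+ k i) <> 0%N.
    apply: contrapT => nri; move: a1; rewrite e rank_sum big1 // => i _.
    by apply: contrapT => ?; apply: nri; exists i.
  have [c ec] : exists c, a = g i *+ k i + c.
    by exists (\sum_(j | j != i) g j *+ k j); rewrite e (bigD1 i).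
  have rc := rankD rH (g i *+ k i) c.
  have c0 : c = 0 by apply: (rank_eq0 rH); rewrite -ec a1 in rc; lia.
  move: rc; rewrite -ec a1 c0 rank0 addn0 rankMn => /esym/eqP.
  rewrite muln_eq1 => /andP[/eqP k1 _].
  by exists i => //; rewrite ec c0 k1 addr0 mulr1n.
pose g (i : 'I_(size s)) := nth 0 s i.
pose rep a := exists k : 'I_(size s) -> nat, a = \sum_i g i *+ k i.
have rep0 : rep 0 by exists (fun=> 0%N); rewrite big1.
have repD a b : rep a -> rep b -> rep (a + b).
  move=> [k ->] [l ->]; exists (fun i => (k i + l i)%N).
  by rewrite -big_split; apply: eq_bigr => i _; rewrite mulrnDr.
have rep1 a : rk a = 1%N -> rep a.
  move=> a1; have /(nthP 0)[i si <-] : a \in s.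
    by have : [set x | rk x = 1%N] a by []; rewrite sE.
  exists (fun j => (j == Ordinal si) : nat); rewrite (bigD1 (Ordinal si)) //= eqxx mulr1n.
  by rewrite big1 ?addr0 // => j /negbTE ->; rewrite mulr0n.
exists (size s), g => a; have [t [t1 <-]] := rank1_sum a.
elim: t t1 => [_|u t IH t1]; first by rewrite big_nil.
rewrite big_cons; apply: repD; first by apply: rep1; apply: t1; rewrite mem_head.
by apply: IH => v vt; apply: t1; rewrite inE vt orbT.
Qed.

(* The operation is x + y - p; its units are the elements of rank one. *)
Lemma shifted_monoid : exists (F : nmodType) (v : F -> H),
  [/\ injective v, forall y, (0 < rk y)%N <-> exists x, v x = y,
      v 0 = p & forall x y, p + v (x + y) = v x + v y].
Proof.
pose T : choiceType := {x : H | (0 < rk x)%N}.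
have p0 : (0 < rk p)%N by rewrite (rank_base rH).
have mulT_ex (x y : T) : exists z : T, p + val z = val x + val y.
  have xy : (2 <= rk (val x + val y))%N.
    by rewrite (rankD rH); have := valP x; have := valP y; rewrite /=; lia.
  have [z e] := rank_ge2 rH xy.
  have z0 : (0 < rk z)%N.
    by move: xy; rewrite e (rankD rH) (rank_base rH); lia.
  by exists (exist _ z z0).
pose mulT (x y : T) : T := sval (cid (mulT_ex x y)).
have mulTE (x y : T) : p + val (mulT x y) = val x + val y := svalP (cid (mulT_ex x y)).
pose oneT : T := exist _ p p0.
have TP (x y : T) : p + val x = p + val y -> x = y.
  by move=> /(base_cancel rH) e; exact: val_inj.
have mulTA : associative mulT.
  move=> x y z; apply: TP; apply: (base_cancel rH).
  rewrite !mulTE addrCA mulTE [p + (_ + _)]addrA mulTE; exact: addrA.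
have mulTC : commutative mulT by move=> x y; apply: TP; rewrite !mulTE addrC.
have mul1T : left_id oneT mulT by move=> x; apply: TP; rewrite mulTE.
pose F : nmodType := HB.pack_for nmodType T (GRing.isNmodule.Build T mulTA mulTC mul1T).
exists F, (val : T -> H); split; [exact: val_inj|move=> y|by []|exact: mulTE].
split=> [y0|[x <-]]; [by exists (exist _ y y0)|exact: (valP x)].
Qed.

(** In the shifted monoid, rank minus one is the valuation, the elements of rank one are the units,
    and the prime is p + p. *)
Lemma ranked_finitely_primary : finitely_primary H 1 1.
Proof.
have canc := ranked_cancellative.
have [F [v [v_inj v_surj v0 vD]]] := shifted_monoid.
have v_gt0 x : (0 < rk (v x))%N by apply/v_surj; exists x.
have vP x y : p + v x = p + v y -> x = y by move=> /(base_cancel rH)/v_inj.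
have rv x y : rk (v (x + y)) = (rk (v x) + rk (v y)).-1.
  by have := congr1 rk (vD x y); rewrite !(rankD rH) (rank_base rH); lia.
have Fcanc : cancellative F.
  by move=> x y z e; apply: v_inj; apply: (canc (v x)); rewrite -!vD e.
have unitF x : mon_unit x <-> rk (v x) = 1%N.
  split=> [[y xy]|x1].
    have := rv x y; rewrite xy v0 (rank_base rH).
    by have := v_gt0 x; have := v_gt0 y; lia.
  have [y y1 e] := rank1_inverse x1.
  have [|y' ey'] := (v_surj y).1; first by rewrite y1.
  by exists y'; apply: vP; rewrite vD ey' v0.
have [|pi epi] := (v_surj (p + p)).1; first by rewrite (rankD rH) (rank_base rH).
have piE x : v (pi + x) = v x + p.
  by apply: (base_cancel rH); rewrite vD epi -addrA [v x + p]addrC.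
(* Divisibility by an element of rank two depends on the rank alone; as rank minus one is additive,
   every such element is prime. *)
have dvdF (q a : F) : rk (v q) = 2%N -> mon_dvd q a <-> (2 <= rk (v a))%N.
  move=> q2; split=> [[c ->]|a2]; first by rewrite rv q2; have := v_gt0 c; lia.
  have [u u1 eu] := rank_succ q2; have [w ew] := rank1_dvd u1 a2.
  have [|w' ew'] := (v_surj w).1; first by move: a2; rewrite ew (rankD rH) u1; lia.
  by exists w'; apply: vP; rewrite vD eu ew' ew mulr1n; exact: addrA.
have primeF (q : F) : rk (v q) = 2%N -> mon_prime q.
  move=> q2; split=> [/unitF|a b]; first by rewrite q2.
  rewrite !dvdF // rv; have [a2|a2] := leqP 2 (rk (v a)); first by left.
  by move=> ab; right; lia.
have rpi : rk (v pi) = 2%N by rewrite epi (rankD rH) (rank_base rH).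
have piMn u k : v (u + pi *+ k) = p *+ k + v u.
  elim: k => [|k IH]; first by rewrite mulr0n addr0 add0r.
  by rewrite mulrSr addrA [u + _ + _]addrC piE IH mulrSr addrAC.
(* The shift by p sends 0 to the identity of F and raises a rank r to valuation r. *)
have /choice[iota0 iotaE] x : exists y, v y = x + p.
  by apply/v_surj; rewrite (rankD rH) (rank_base rH); lia.
have iota_add : nmod_morphism iota0.
  split=> [|x y]; first by apply: v_inj; rewrite iotaE add0r.
  by apply: vP; rewrite vD !iotaE addrCA addrACA addrA.
pose iota : {additive H -> F} := HB.pack_for {additive H -> F} iota0
  (GRing.isNmodMorphism.Build H F iota0 iota_add).
have rank2F n (a : F) : rk (v a) = n.+2 ->
    exists q : 'I_n.+1 -> F, (forall i, rk (v (q i)) = 2%N) /\ a = \sum_i q i.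
  elim: n a => [|n IH] a an; first by exists (fun=> a); rewrite big_ord1.
  have [|y e] := rank_ge2 rH (x := v a); first by rewrite an.
  have yn : rk y = n.+2 by have := rankD rH p y; rewrite -e an (rank_base rH); lia.
  have [|y' ey] := (v_surj y).1; first by rewrite yn.
  have [|q [q2 eq]] := IH y'; first by rewrite ey.
  exists (fun i => if unlift ord0 i is Some j then q j else pi); split=> [i|].
    by case: unliftP.
  rewrite big_ord_recl unlift_none (eq_bigr q); last by move=> i _; rewrite liftK.
  by rewrite -eq; apply: v_inj; rewrite piE e ey addrC.
split=> //; exists F, (fun=> pi), iota; split.
- split=> // a /unitF a1; have a0 := v_gt0 a.
  case Ea : (rk (v a)) a0 a1 => [|[|n]] // _ _; have [q [q2 eq]] := rank2F n a Ea.
  by exists n.+1, q; split=> // i; exact: primeF.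
- split=> [_|i j _|a|u w k l /unitF u1 /unitF w1].
  + exact: primeF.
  + by rewrite !ord1.
  + have a0 := v_gt0 a; case Ea : (rk (v a)) a0 => [|n] // _.
    have [y y1 e] := rank_succ Ea; have [|y' ey] := (v_surj y).1; first by rewrite y1.
    exists y', (fun=> n); split; first by apply/unitF; rewrite ey.
    by apply: v_inj; rewrite big_ord1 piMn ey.
  + rewrite !big_ord1 => /(congr1 v); rewrite !piMn => e.
    have kl : k ord0 = l ord0.
      by have := congr1 rk e; rewrite !(rankD rH) !rankMn (rank_base rH) u1 w1; lia.
    split; last by move=> i; rewrite ord1.
    by apply: v_inj; rewrite kl in e; exact: base_cancelMn e.
- move=> x y /(congr1 v); rewrite /= !iotaE ![_ + p]addrC; exact: (base_cancel rH).
- move=> a /ranked_nonunit a0; have [a' ea] := (v_surj a).1 a0; rewrite big_ord1; exists a'.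
  by apply: v_inj; rewrite piE ea; exact: iotaE.
(* Multiplication by pi in F adds p in H, exactly as the embedding does; hence pi + F lies in the
   image. *)
- move=> b; exists (v b); rewrite big_ord1 mulr1n.
  by apply: v_inj; rewrite piE; exact: iotaE.
Qed.

End RankedMonoid.

(** * Multisets *)

Section Multisets.
Variable T : choiceType.
Implicit Types (A B C : {mset T}%mset).

Lemma perm_msetD A B : perm_eq (A `+` B)%mset (A ++ B).
Proof.
have -> : (A `+` B)%mset = seq_mset (A ++ B).
  by apply/msetP => a; rewrite mset_seqE count_cat !count_mem_mset msetE2.
exact: perm_eq_seq_mset.
Qed.

Lemma size_msetD A B : size (A `+` B)%mset = (size A + size B)%N.
Proof. by rewrite (perm_size (perm_msetD A B)) size_cat. Qed.

Lemma size_mset1 (a : T) : size [mset a]%mset = 1%N.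
Proof. by rewrite enum_msetn. Qed.

Lemma size_msubset A B : (A `<=` B)%mset -> (size A <= size B)%N.
Proof. by move=> AB; rewrite -(msetBDKC AB) size_msetD leq_addr. Qed.

Lemma size_msetB A B : (size (A `\` B)%mset <= size A)%N.
Proof. by apply: size_msubset; apply/msubsetP => a; rewrite msetE2 leq_subr. Qed.

Lemma size_mset_eq0 A : size A = 0%N -> A = mset0.
Proof.
move=> /size0nil A0; apply/msetP => a.
by rewrite -count_mem_mset A0 mset0E.
Qed.

Lemma size_mset_gt0 A : (0 < size A)%N -> exists2 a, a \in A & A = (a +` (A `\ a))%mset.
Proof.
case EA : (enum_mset A) => [|a s] // _.
have aA : a \in A by rewrite in_mset -count_mem_mset EA /= eqxx.
by exists a => //; rewrite msetB1K.
Qed.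

Lemma big_msetD (V : nmodType) (F : T -> V) A B :
  \sum_(a <- (A `+` B)%mset) F a = \sum_(a <- A) F a + \sum_(a <- B) F a.
Proof. by rewrite (perm_big _ (perm_msetD A B)) big_cat. Qed.

Lemma big_mset1 (V : nmodType) (F : T -> V) a : \sum_(b <- [mset a]%mset) F b = F a.
Proof. by rewrite enum_msetn big_seq1. Qed.

End Multisets.

(** * Arithmetic of ranked monoids *)

Section LeastElement.
Implicit Types P : nat -> Prop.

Lemma leastE P n : P n -> (forall m, P m -> (n <= m)%N) -> least P = Some n.
Proof.
move=> Pn Pmin; rewrite /least; case: pselect => [exP|]; last first.
  by case; exists n; apply/asboolP.
case: ex_minnP => m /asboolP Pm m_min; congr Some; apply/eqP; rewrite eqn_leq.
by rewrite Pmin // m_min //; apply/asboolP.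
Qed.

Lemma le_ext_least P n : P n -> le_ext (least P) n.
Proof.
move=> Pn; rewrite /least; case: pselect => [exP|]; last by case; exists n; apply/asboolP.
by case: ex_minnP => m _ /=; apply; apply/asboolP.
Qed.

Lemma le_ext_leastP P n : le_ext (least P) n -> exists2 m, P m & (m <= n)%N.
Proof.
rewrite /least; case: pselect => [exP|//]; case: ex_minnP => m /asboolP Pm _ /= mn.
by exists m.
Qed.

(** Catenary and tame degree are both suprema of minima: a uniform bound n and a single x attaining
    it determine them. *)
Lemma sup_ext_leastE (T : Type) (D : set T) (P : T -> nat -> Prop) n :
  (forall x, D x -> P x n) ->
  (exists2 x, D x & forall m, P x m -> (n <= m)%N) ->
  sup_ext [set least (P x) | x in D] = Some n.
Proof.
move=> Pn [x Dx xn]; apply: leastE => [_ [y Dy <-]|m Pm].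
  by apply: le_ext_least; exact: Pn.
have [|k Pk km] := @le_ext_leastP (P x) m; first by apply: Pm; exists x.
exact: leq_trans (xn _ Pk) km.
Qed.

End LeastElement.

(** * Factorizations, lengths, catenary and tame degree *)

Section Arithmetic.
Variables (H : nmodType) (rk0 : H -> nat) (p0 : H).
Hypothesis rH : ranked_monoid rk0 p0.

Lemma red_coset_inj : injective (@red_coset H).
Proof.
move=> a b /eqP; rewrite /red_coset eqmodE => /asboolP[u /(ranked_unit rH) -> ->].
by rewrite addr0.
Qed.

Lemma red_coset_repr (x : Hred H) : red_coset (repr x) = x.
Proof. exact: reprK. Qed.

Let G := Hred H.
Let rk (x : G) := rk0 (repr x).
Let p : G := red_coset p0.

Lemma repr_red_coset (a : H) : repr (red_coset a) = a.
Proof. by apply: red_coset_inj; rewrite red_coset_repr. Qed.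

Lemma reprD (x y : G) : repr (x + y) = repr x + repr y :> H.
Proof.
rewrite -[x in LHS]red_coset_repr -[y in LHS]red_coset_repr -red_cosetD.
exact: repr_red_coset.
Qed.

(** Zero is the only unit of H, so the reduced monoid is a copy of H and the rank transfers along
    representatives. *)
Lemma ranked_red : ranked_monoid rk p.
Proof.
split=> [x y|x|||x y|x].
- by rewrite /rk reprD (rankD rH).
- by move=> /(rank_eq0 rH) e; rewrite -[x]red_coset_repr e.
- by rewrite /rk repr_red_coset (rank_base rH).
- move=> x /(rank_ge2 rH)[y e]; exists (red_coset y).
  by rewrite -red_cosetD -e red_coset_repr.
- move=> /(congr1 repr); rewrite !reprD !repr_red_coset => /(base_cancel rH) e.
  by rewrite -[x]red_coset_repr e red_coset_repr.
- have [y [n e]] := dvd_base rH (repr x); exists (red_coset y), n.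
  rewrite -[x]red_coset_repr -red_cosetD e.
  by elim: n {e} => [|n IH] //; rewrite !mulrS red_cosetD IH.
Qed.

Implicit Types (x y u : G) (z w : {mset G}%mset).

Let cancG := ranked_cancellative ranked_red.

(** Atoms have rank one and the rank is additive; this is half-factoriality. *)
Lemma fact_size x z : fact_red x z -> size z = rk x.
Proof.
move=> [zA <-]; rewrite (rank_sum ranked_red) -sum1_size big_seq [RHS]big_seq.
by apply: eq_bigr => u uz; apply/esym/(ranked_atom ranked_red); exact: zA.
Qed.

Lemma fact_ex x : exists z, fact_red x z.
Proof.
have [s [s1 <-]] := rank1_sum ranked_red x; exists (seq_mset s); split.
  by move=> u; rewrite (perm_mem (perm_eq_seq_mset s)) => /s1/(ranked_atom ranked_red).
exact/perm_big/perm_eq_seq_mset.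
Qed.

Lemma ranked_half_factorial : half_factorial H.
Proof.
split=> [|a]; first exact: ranked_atomic rH.
exists (rk (red_coset a)); apply/seteqP; split=> [_ [z /fact_size <- <-]//|_ ->].
have [z fz] := fact_ex (red_coset a); exists z => //; exact: fact_size.
Qed.

Lemma fact_msetD x y z w : fact_red x z -> fact_red y w -> fact_red (x + y) (z `+` w)%mset.
Proof.
move=> [zA <-] [wA <-]; split; last by rewrite big_msetD.
by move=> u /msetDP[/zA|/wA].
Qed.

Lemma fact_mset1 x : rk x = 1%N -> fact_red x [mset x]%mset.
Proof.
move=> x1; split; last by rewrite big_mset1.
by move=> u; rewrite in_mset1 => /eqP ->; apply/(ranked_atom ranked_red).
Qed.

Lemma fact_msub x z w : (w `<=` z)%mset -> fact_red x z -> exists y, fact_red y w.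
Proof.
move=> wz [zA _]; exists (\sum_(u <- w) u); split=> // u uw; apply: zA.
exact: (msubset_subset wz).
Qed.

Lemma fact_split x z u : fact_red x z -> u \in z ->
  rk u = 1%N /\ exists2 y, x = u + y & fact_red y (z `\ u)%mset.
Proof.
move=> [zA zx] uz; split; first exact/(ranked_atom ranked_red)/zA.
have e := msetB1K uz; exists (\sum_(v <- (z `\ u)%mset) v).
  by rewrite -zx -[in LHS]e big_msetD big_mset1.
split=> // v vz; apply: zA; rewrite -e in_mset1D vz orbT //.
Qed.

Lemma fact_unique_le1 x z z' : fact_red x z -> fact_red x z' -> (rk x <= 1)%N -> z = z'.
Proof.
move=> fz fz'; have sz := fact_size fz; have sz' := fact_size fz'.
case Ex : (rk x) sz sz' => [|[|//]] sz sz' _.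
  by rewrite (size_mset_eq0 sz) (size_mset_eq0 sz').
have single w : fact_red x w -> size w = 1%N -> w = [mset x]%mset.
  move=> [_ wx] w1; have [|a aw e] := @size_mset_gt0 _ w; first by rewrite w1.
  have wa : (w `\ a)%mset = mset0.
    apply: size_mset_eq0; have := congr1 (fun A : {mset G}%mset => size A) e.
    by rewrite size_msetD size_mset1 w1; lia.
  rewrite e wa msetD0 big_mset1 in wx.
  by rewrite e wa msetD0 wx.
by rewrite (single z) // (single z').
Qed.

Lemma fact_distDl w z z' : fact_dist (w `+` z)%mset (w `+` z')%mset = fact_dist z z'.
Proof. by rewrite /fact_dist -msetDIr !msetBDl. Qed.

Lemma fact_dist_le z z' n : (size z <= n)%N -> (size z' <= n)%N -> (fact_dist z z' <= n)%N.
Proof.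
by move=> zn z'n; rewrite /fact_dist geq_max !(leq_trans (size_msetB _ _)).
Qed.

Let step x : rel {mset G}%mset :=
  fun z z' => `[< fact_red x z' >] && (fact_dist z z' <= 2)%N.

(* Replace two atoms x1, x2 of z by y, w with y an atom of z' and x1 + x2 = y + w,
   then cancel y and recurse. *)
Lemma fact_path n x z z' : rk x = n -> fact_red x z -> fact_red x z' ->
  exists2 s, path (step x) z s & last z s = z'.
Proof.
elim: n x z z' => [|n IH] x z z' xn fz fz'.
  by exists [::] => //=; apply: fact_unique_le1 fz fz' _; rewrite xn.
have [|y yz' ez'] := @size_mset_gt0 _ z'; first by rewrite (fact_size fz') xn.
have [y1 [x' ex fx']] := fact_split fz' yz'.
have x'n : rk x' = n by have := rankD ranked_red y x'; rewrite -ex xn y1; lia.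
(* Adding the common atom y to every member of a chain for x' leaves the distances unchanged. *)
have common w : fact_red x' w ->
    exists2 s, path (step x) (y +` w)%mset s & last (y +` w)%mset s = z'.
  move=> fw; have [s ps ls] := IH _ _ _ x'n fw fx'.
  exists [seq (y +` v)%mset | v <- s]; last by rewrite last_map ls -ez'.
  rewrite path_map; apply: sub_path ps => v v' /andP[/asboolP fv' d].
  apply/andP; split; last by rewrite fact_distDl.
  by apply/asboolP; rewrite ex; apply: fact_msetD fv'; exact: fact_mset1.
have [yz|yz] := boolP (y \in z).
  have [_ [x'' ex'' fx'']] := fact_split fz yz.
  rewrite -(msetB1K yz); apply: common.
  by rewrite (cancG (etrans (esym ex) ex'')).
have [|a az ea] := @size_mset_gt0 _ z; first by rewrite (fact_size fz) xn.
have [a1 [xa exa fxa]] := fact_split fz az.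
have xan : rk xa = n by have := rankD ranked_red a xa; rewrite -exa xn a1; lia.
have n0 : (0 < n)%N.
  rewrite lt0n; apply/eqP => n0; move/negP: yz; apply.
  by rewrite (fact_unique_le1 fz fz') // xn n0.
have [|b bz eb] := @size_mset_gt0 _ (z `\ a)%mset; first by rewrite (fact_size fxa) xan.
have [b1 [xb exb fxb]] := fact_split fxa bz.
have [|t et] := rank1_dvd ranked_red y1 (x := a + b).
  by rewrite (rankD ranked_red) a1 b1.
have t1 : rk t = 1%N.
  by have := congr1 rk et; rewrite !(rankD ranked_red) a1 b1 y1; lia.
set w0 := (z `\ a `\ b)%mset in eb fxb.
have fw : fact_red x' (t +` w0)%mset.
  have -> : x' = t + xb.
    by apply: (cancG (a := y)); rewrite -ex exa exb !addrA et.
  by apply: fact_msetD fxb; exact: fact_mset1.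
have [s ps ls] := common _ fw.
exists ((y +` (t +` w0))%mset :: s) => //=; rewrite ps andbT.
apply/andP; split.
  by apply/asboolP; rewrite ex; apply: fact_msetD fw; exact: fact_mset1.
(* The exchange of a, b for y, t fixes the part [w0], so only multisets of size two are compared. *)
rewrite {1}ea eb !msetDA ![(_ `+` w0)%mset]msetDC fact_distDl.
by apply: fact_dist_le; rewrite size_msetD !size_mset1.
Qed.

Lemma ranked_chain_connected (a : H) : chain_connected a 2.
Proof.
move=> z z' fz fz'; have [s ps ls] := fact_path erefl fz fz'.
exists (size s), (fun i => nth z (z :: s) i); split=> // [|i|i si].
- by rewrite -ls (last_nth z).
- case: i => [//|i] si; have /andP[/asboolP] := pathP z ps i si.
  by [].
- by have /andP[] := pathP z ps i si.
Qed.

(** Once the common part is removed, both remainders factor the same element, and its rank is at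
    most one. *)
Lemma fact_dist_le1 x z z' : fact_red x z -> fact_red x z' ->
  (fact_dist z z' <= 1)%N -> z = z'.
Proof.
move=> fz fz'; rewrite /fact_dist geq_max => /andP[].
set D := (z `&` z')%mset => d d'.
have Dz : (D `<=` z)%mset by apply/msubsetP => a; rewrite msetE2 geq_minl.
have Dz' : (D `<=` z')%mset by apply/msubsetP => a; rewrite msetE2 geq_minr.
have ez := msetBDKC Dz; have ez' := msetBDKC Dz'.
rewrite -ez -ez'; congr (_ `+` _)%mset.
have subB A : (A `\` D `<=` A)%mset by apply/msubsetP => a; rewrite msetE2 leq_subr.
have [y fy] := fact_msub (subB z) fz; have [y' fy'] := fact_msub (subB z') fz'.
have yy' : y = y'.
  apply: (cancG (a := \sum_(u <- D) u)).
  case: fy fy' => _ <- [_ <-]; rewrite -!big_msetD ez ez'.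
  by case: fz fz' => _ -> [_ ->].
by rewrite -yy' in fy'; apply: (fact_unique_le1 fy fy'); rewrite -(fact_size fy).
Qed.

Section TwoClasses.
Variable g0 : H.
Hypotheses (g0_1 : rk0 g0 = 1%N) (g0_p : g0 <> p0).

(** h is the inverse of g in the group with identity p, so h = p would force g = p. *)
Lemma two_factorizations : exists (g h : G), [/\ rk g = 1%N, rk h = 1%N,
  g + h = p + p, g <> p & h <> p].
Proof.
have g1 : rk (red_coset g0) = 1%N by rewrite /rk repr_red_coset.
have [h h1 e] := rank1_inverse ranked_red g1.
have gp : red_coset g0 <> p by move=> /red_coset_inj.
exists (red_coset g0), h; split=> // hp; apply: gp.
by apply: (cancG (a := p)); rewrite addrC -e hp.
Qed.

Lemma rank_p : rk p = 1%N. Proof. exact: rank_base ranked_red. Qed.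

Lemma ranked_catenary_degree : catenary_degree H = Some 2.
Proof.
apply: sup_ext_leastE => [a _|]; first exact: ranked_chain_connected.
have [g [h [g1 h1 e gp hp]]] := two_factorizations.
exists (p0 + p0) => // m cm; rewrite ltnNge; apply/negP => m1.
have fp : factorizations (p0 + p0) [mset p; p]%mset.
  by rewrite /factorizations red_cosetD; apply: fact_msetD; exact/fact_mset1/rank_p.
have fg : factorizations (p0 + p0) [mset g; h]%mset.
  by rewrite /factorizations red_cosetD -/p -e; apply: fact_msetD; exact: fact_mset1.
have [k [c [c0 ck cf cd]]] := cm _ _ fp fg.
(* A chain with steps of length at most one is constant, so it cannot lead from p + p to g + h. *)
have cc i : (i <= k)%N -> c i = [mset p; p]%mset.
  elim: i => [//|i IH] ik; rewrite -(IH (ltnW ik)); apply/esym.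
  by apply: fact_dist_le1 (cf _ (ltnW ik)) (cf _ ik) (leq_trans (cd _ ik) m1).
have : g \in [mset p; p]%mset by rewrite -(cc k) // ck mset21.
by rewrite in_mset2 => /orP[] /eqP.
Qed.

Lemma ranked_tame_degree : tame_degree H = Some 2.
Proof.
apply: sup_ext_leastE => [u /= /(ranked_atom ranked_red) u1 a z ua fz uz|].
  have [c ec] := ua.
  (* A single factor would mean a = u, and then z would contain u. *)
  have z2 : (2 <= size z)%N.
    rewrite ltnNge; apply/negP => z1; move/negP: uz; apply.
    rewrite (fact_size fz) in z1.
    have rc := rankD ranked_red u c.
    have c0 : c = 0 by apply: (rank_eq0 ranked_red); rewrite -ec u1 in rc; lia.
    rewrite ec c0 addr0 in fz z1.
    by rewrite (fact_unique_le1 fz (fact_mset1 u1) z1) in_mset1.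
  have [|b bz eb] := @size_mset_gt0 _ z; first by lia.
  have [b1 [xb exb fxb]] := fact_split fz bz.
  have zb : (0 < size (z `\ b)%mset)%N.
    by have := congr1 (fun A : {mset G}%mset => size A) eb; rewrite size_msetD size_mset1; lia.
  have [d dz ed] := size_mset_gt0 zb; have [d1 _] := fact_split fxb dz.
  have [|t et] := rank1_dvd ranked_red u1 (x := b + d).
    by rewrite (rankD ranked_red) b1 d1.
  have t1 : rk t = 1%N.
    by have := congr1 rk et; rewrite !(rankD ranked_red) b1 d1 u1; lia.
  exists [mset b; d]%mset, [mset t]%mset; split.
  - apply/msubsetP => v.
    by rewrite [z in X in (_ <= X)%N]eb ed msetDA [X in (_ <= X)%N]msetE2 leq_addr.
  - by move=> v; rewrite in_mset1 => /eqP ->; apply/(ranked_atom ranked_red).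
  - by rewrite big_msetD !big_mset1.
  - by rewrite size_msetD !size_mset1.
have [g [h [g1 h1 e gp hp]]] := two_factorizations.
have pA : mon_atom p by apply/(ranked_atom ranked_red); exact: rank_p.
exists p => // m tm; rewrite ltnNge; apply/negP => m1.
have fg : fact_red (p + p) [mset g; h]%mset.
  by rewrite -e; apply: fact_msetD; exact: fact_mset1.
have pz : p \notin [mset g; h]%mset.
  by rewrite in_mset2 negb_or; apply/andP; split; apply/eqP => /esym.
have [|v [w [vz wA vw]]] := tm _ _ _ fg pz; first by exists p.
rewrite geq_max => /andP[w0 v1].
have [y fv] := fact_msub vz fg.
(* A bound below two leaves no room for [w], so v is a factorization of p itself, hence p alone,
   although p does not occur in g + h. *)
have fvp : fact_red p v.
  have w00 : w = mset0 by apply: size_mset_eq0; lia.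
  case: fv => vA _; split=> //; rewrite vw w00.
  by rewrite (_ : \sum_(x <- mset0) x = 0) ?addr0 // enum_mset0 big_nil.
have := fact_unique_le1 fvp (fact_mset1 rank_p); rewrite rank_p => /(_ isT) ev.
by move/negP: pz; apply; apply: (msubset_subset vz); rewrite ev in_mset1.
Qed.

End TwoClasses.
End Arithmetic.

(** * Invertible modules and the Picard group *)

Section InvertibleModules.
Variable R : comNzRingType.
Implicit Types L M N : lmodType R.

Lemma linear_map0 M N (g : M -> N) : linear g -> g 0 = 0.
Proof. by move=> gl; have := gl (-1) 0 0; rewrite scaler0 addr0 scaleN1r addNr. Qed.

Lemma linear_mapZ M N (g : M -> N) a x : linear g -> g (a *: x) = a *: g x.
Proof. by move=> gl; have := gl a x 0; rewrite (linear_map0 gl) !addr0. Qed.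

Lemma linear_mapD M N (g : M -> N) x y : linear g -> g (x + y) = g x + g y.
Proof. by move=> gl; have := gl 1 x y; rewrite !scale1r. Qed.

(** If b vanished, zero and the identity of R would both extend it, against uniqueness. *)
Lemma is_tensor_neq0 M N (b : M -> N -> R^o) : is_tensor b -> exists x y, b x y <> 0.
Proof.
move=> [bb bU]; apply: contrapT => b0.
have {}b0 x y : b x y = 0 by apply: contrapT => bxy; apply: b0; exists x, y.
have [h _ hU] := bU _ _ bb.
have h1 := hU idfun (fun _ _ => erefl) 1.
have h0 : (\0 : {linear R^o -> R^o}) 1 = h 1 by apply: hU => x y; rewrite b0.
by move: h1; rewrite -h0 /= => /eqP; rewrite oner_eq0.
Qed.

(** Every bilinear map factors through the scalar b(u, v). Two test maps, one for each summand, show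
    that b(1, 0) vanishes, and with it all of b. *)
Lemma invertible_module_not_split L (l : L) : (forall r : R, r *: l = 0 -> r = 0) ->
  ~ invertible_module (dsum (R^o : lmodType R) L).
Proof.
move=> l_faithful [N [b bT]]; have [[x y] [w]] := is_tensor_neq0 bT; apply.
have [[bl br] bU] := bT.
pose M := dsum (R^o : lmodType R) L.
have bE r (z : L) v : b (r, z) v = r * b (1, 0) v + b (0, z) v :> R.
  rewrite -[r * _](linear_mapZ r (1, 0) (bl v)) -(linear_mapD _ _ (bl v)).
  congr (b _ v); congr pair; rewrite /= ?addr0 ?scaler0 ?add0r //; exact: (esym (mulr1 r)).
(* This map vanishes at u = (1, 0), so b(1, 0)(v) kills [h1 1]; at u = (0, l) it gives b(1, 0)(v)
   l. *)
have c1 : bilinear_map (fun (u : M) v => (b (1, 0) v : R) *: u.2).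
  split=> [v|u] a s t; first by rewrite scalerDr !scalerA mulrC.
  by rewrite br scalerDl scalerA.
have [h1 h1P _] := bU _ _ c1.
have h1E v u : b u v *: h1 1 = (b (1, 0) v : R) *: u.2.
  by rewrite -h1P -linearZ; congr (h1 _); exact: mulr1.
(* The test map for the first summand makes b(0, l') a multiple of b(1, 0), so its values kill
   [h1 1] too. *)
have b_in_L v l' : exists t, b (0, l') v = t * b (1, 0) v.
  have c2 : bilinear_map (fun (u : M) v' => (b (0, l') v' : R) *: (u.1 : R^o)).
    split=> [v'|u] a s t; first by rewrite scalerDr !scalerA mulrC.
    by rewrite br scalerDl scalerA.
  have [h2 h2P _] := bU _ _ c2; exists (h2 1).
  have <- : h2 (b (1, 0) v) = b (0, l') v by rewrite h2P; exact: mulr1.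
  rewrite [RHS]mulrC -[RHS]/(b (1, 0) v *: h2 1) -linearZ; congr (h2 _).
  exact: (esym (mulr1 _)).
have b1h v : (b (1, 0) v : R) *: h1 1 = 0 by rewrite h1E scaler0.
have b1 v : b (1, 0) v = 0 :> R.
  apply: l_faithful; rewrite -(h1E v (0, l)); have [t ->] := b_in_L v l.
  by rewrite -scalerA b1h scaler0.
rewrite bE; have [t ->] := b_in_L w y.
by rewrite b1 !mulr0 addr0.
Qed.

(** * Rank one classes, the Picard group and indecomposable modules *)

Section PicardRank.
Variables (K : fieldType) (f : {rmorphism R -> K}).
Hypotheses (prufer : prufer_ring R) (half : one_half_generator R).
Hypothesis small : small_zero_divisors R.

(** A regular element of an invertible ideal split off from M has zero annihilator. *)
Lemma cls_faithful M (PM : fg_projective M) : cls PM <> 0 ->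
  exists l : M, forall r : R, r *: l = 0 -> r = 0.
Proof.
move=> /(cls_split prufer small)[_ [z [[I [idI [PI [invI ->]]]] e]]].
have [N [PN ez]] := cls_surj z.
have [a Ia areg] := invertible_regular_ideal invI.
have PIN := fg_projective_dsum PI PN.
have /mod_iso_sym/mod_isoP[h [k [hk _]]] : mod_iso M (dsum (ideal_mod idI) N).
  by apply/(clsP PM PIN); rewrite e ez -cls_dsum.
pose a' : ideal_mod idI := submod_of (ideal_submodule idI) (Ia : (I : set R^o) a).
exists (h (a', 0)) => r /(congr1 k); rewrite -linearZ hk linear0.
move=> /(congr1 fst)/(congr1 (@elt _ _ idI)) e0.
by apply: areg; rewrite mulr0 mulrC; exact: e0.
Qed.

(** Rank zero contradicts a nonzero value of the pairing; rank at least two gives R plus a nonzero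
    module, which is not invertible. Conversely, rank one classes are invertible ideals. *)
Lemma invertible_module_rank L : invertible_module L <->
  exists PL : fg_projective L, cls_rank f (cls PL) = 1%N.
Proof.
split=> [invL|[PL]]; last first.
  move=> /(cls_rank_eq1 f prufer small)[I [idI [PI [invI /clsP e]]]].
  apply: invertible_module_iso (mod_iso_sym e) _.
  have [d [n [x [r Ib]]]] := invertible_inverse_basis invI.
  exact: inverse_basis_invertible_module Ib.
have dL := invertible_dual_basis invL.
have PL : fg_projective L by split; [exact: dual_basis_fin_gen|exact: dual_basis_projective].
exists PL; have [r0|r1] := posnP (cls_rank f (cls PL)).
  have P0 := fg_projective_zero R.
  have /mod_isoP[h [k [hk _]]] : mod_iso L (zero_module R).
    by apply/(clsP PL P0); rewrite cls_zero; exact: cls_rank_eq0 r0.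
  have [N [b bT]] := invL; have [x [y]] := is_tensor_neq0 bT; case.
  have x0 : x = 0 by rewrite -[x]hk (_ : h x = 0) ?linear0 //; apply/matrixP => i [].
  by rewrite x0; case: bT => [[bl _] _]; exact: linear_map0 (bl y).
have [r2|] := ltnP 1 (cls_rank f (cls PL)); last by lia.
have [y ey] := cls_rank_ge2 prufer half small r2.
have [L' [PL' ey']] := cls_surj y.
have y0 : cls PL' <> 0.
  by move=> y0; move: r2; rewrite ey ey' y0 addr0 cls_rank_cls1.
have [l l_faithful] := cls_faithful y0.
case: (invertible_module_not_split l_faithful); apply: invertible_module_iso invL.
have Pd := fg_projective_dsum (fg_projective_free1 R) PL'.
by apply/(clsP PL Pd); rewrite ey ey' -cls_dsum.
Qed.

Lemma finite_Pic : finite_set [set: Pic R] <->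
  finite_set [set x : class_monoid (proj_class R) | cls_rank f x = 1%N].
Proof.
have repP (q : Pic R) := (invertible_module_rank _).1 (class_repP q).
(* Pic and V are quotients of different sets of representatives; phi matches their classes through
   the underlying modules. *)
have /choice[phi phiP] (q : Pic R) :
    exists x, exists PL : fg_projective (class_rep q), x = cls PL /\ cls_rank f x = 1%N.
  by have [PL e] := repP q; exists (cls PL), PL.
have phi_inj : injective phi.
  move=> q q' e; have [PL [eL _]] := phiP q; have [PL' [eL' _]] := phiP q'.
  rewrite -[q]iso_class_rep -[q']iso_class_rep; apply/iso_classP/(clsP PL PL').
  by rewrite -eL -eL'.
have -> : [set x | cls_rank f x = 1%N] = range phi.
  apply/seteqP; split=> [x /= x1|_ [q _ <-]]; last by have [? []] := phiP q.
  have [M [PM e]] := cls_surj x.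
  have invM : invertible_module M by apply/invertible_module_rank; exists PM; rewrite -e.
  exists (@iso_class R (invertible_class R) M invM) => //.
  set q := iso_class _; have [PL [-> _]] := phiP q.
  rewrite e; apply/(clsP PL PM).
  apply/(@iso_classP R (invertible_class R) _ _ (class_repP q) invM).
  exact: iso_class_rep.
split=> [|fin]; first exact: finite_image.
rewrite (_ : [set: Pic R] = phi @^-1` range phi); last first.
  by apply/seteqP; split=> // q _; exists q.
by apply: finite_preimage => // q q' _ _; exact: phi_inj.
Qed.

(** From rank two on, R splits off with a nonzero complement; rank one cannot be divided between two
    nonzero summands. *)
Lemma indecomposable_rank1 M (PM : fg_projective M) :
  indecomposable M <-> cls_rank f (cls PM) = 1%N.
Proof.
have P0 := fg_projective_zero R.
have is0 N (PN : fg_projective N) : mod_iso N (zero_module R) <-> cls_rank f (cls PN) = 0%N.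
  split=> [/(clsP PN P0) ->|/(cls_rank_eq0 prufer small) e].
    by rewrite cls_zero cls_rank0.
  by apply/(clsP PN P0); rewrite cls_zero.
split=> [[M0 Mind]|M1].
  have [r0|r1] := posnP (cls_rank f (cls PM)); first by case: M0; apply/is0.
  have [r2|] := ltnP 1 (cls_rank f (cls PM)); last by lia.
  have [y ey] := cls_rank_ge2 prufer half small r2; have [N [PN eN]] := cls_surj y.
  pose P1 := fg_projective_free1 R; have Pd := fg_projective_dsum P1 PN.
  have [|/(is0 _ P1)|/(is0 _ PN)] := Mind R^o N.
  - by apply/(clsP PM Pd); rewrite ey eN -cls_dsum.
  - by rewrite [cls_rank f _](cls_rank_cls1 f).
  - by move: r2; rewrite ey eN cls_rankD cls_rank_cls1 => /[swap] ->.
split=> [/(is0 _ PM)|A B e]; first by rewrite M1.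
have [PA [PB eAB]] := cls_iso_dsum PM e.
have := M1; rewrite eAB cls_rankD => rAB.
by case EA : (cls_rank f (cls PA)) rAB => [|n] rAB; [left|right]; apply/is0; lia.
Qed.

Lemma cls_dsums n (A : 'I_n -> lmodType R) (PA : forall i, fg_projective (A i)) :
  exists P : fg_projective (dsums A), cls P = \sum_i cls (PA i).
Proof.
elim: n A PA => [|n IH] A PA.
  have P0 := fg_projective_zero R.
  by exists P0; rewrite big_ord0 cls_zero.
have [P e] := IH _ (fun i => PA (lift ord0 i)).
have Pd := fg_projective_dsum (PA ord0) P.
by exists Pd; rewrite big_ord_recl -e -cls_dsum.
Qed.

(** Every indecomposable is then R, and the number of summands is the rank. The contrapositive turns
    failure of KRSA into a second rank one class. *)
Lemma KRSA_rank1 : (forall x, cls_rank f x = 1%N -> x = cls1 R) -> KRSA (proj_class R).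
Proof.
move=> rank1; pose P1 := fg_projective_free1 R.
have ind1 (M : lmodType R) : fg_projective M /\ indecomposable M -> mod_iso M R^o.
  move=> [PM /(indecomposable_rank1 PM)/rank1 e]; exact/(clsP PM P1).
split=> [M PM|m n A B AP BP e].
  pose n := cls_rank f (cls PM); exists n, (fun=> R^o); split=> [i|].
    by split=> //; apply/(indecomposable_rank1 P1); exact: cls_rank_cls1.
  have [Pd ed] := cls_dsums (fun _ : 'I_n => P1).
  apply/(clsP PM Pd); rewrite ed sumr_const card_ord /n.
  case En : (cls_rank f (cls PM)) => [|k].
    by rewrite mulr0n; exact: cls_rank_eq0 En.
  have [y /(cls_rank_ideal f)/rank1 ey ->] := cls_rankS prufer half small En.
  by rewrite ey mulrSr.
have rank_dsums k (C : 'I_k -> lmodType R)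
    (CP : forall i, fg_projective (C i) /\ indecomposable (C i)) :
    exists P : fg_projective (dsums C), cls_rank f (cls P) = k.
  have [P eP] := cls_dsums (fun i => (CP i).1); exists P.
  have -> : cls P = cls1 R *+ k.
    rewrite eP -[k in RHS]card_ord -sumr_const; apply: eq_bigr => i _.
    by apply/clsP; exact: ind1.
  elim: k {C CP P eP} => [|k IH]; first by rewrite mulr0n cls_rank0.
  by rewrite mulrS cls_rankD IH cls_rank_cls1.
have [PA rA] := rank_dsums _ _ AP; have [PB rB] := rank_dsums _ _ BP.
have mn : m = n by rewrite -rA -rB; congr (cls_rank f _); exact/clsP.
subst n; exists id; first by exists id.
move=> i; have Ai := ind1 _ (AP i); have Bi := ind1 _ (BP i).
exact: mod_iso_trans Ai (mod_iso_sym Bi).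
Qed.

Lemma cls_ranked_monoid : ranked_monoid (cls_rank f) (cls1 R).
Proof.
split.
- exact: cls_rankD.
- exact: cls_rank_eq0.
- exact: cls_rank_cls1.
- exact: cls_rank_ge2.
- exact: (cls1_cancel f prufer half small).
- exact: cls_dvd_free.
Qed.

End PicardRank.
End InvertibleModules.

Local Close Scope classical_set_scope.
Local Close Scope ring_scope.

Theorem theorem5p1 (R : comNzRingType) (hPrufer : prufer_ring R)
    (hGen : one_half_generator R) (hSmall : small_zero_divisors R) :
  (finitely_primary (class_monoid (proj_class R)) 1 1 /\
   (fin_gen_monoid (class_monoid (proj_class R)) <->
    finite_set [set: Pic R])) /\
  (~ KRSA (proj_class R) ->
   [/\ half_factorial (class_monoid (proj_class R)),
       catenary_degree (class_monoid (proj_class R)) = Some 2 &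
       tame_degree (class_monoid (proj_class R)) = Some 2]).
Proof.
have [M maxM] := @maximal_ideal_ex R; have [K [f _]] := residue_field maxM.
have rV := cls_ranked_monoid f hPrufer hGen hSmall.
split; first split.
- exact: ranked_finitely_primary rV.
- have finPic := finite_Pic f hPrufer hGen hSmall.
  by split=> [/(ranked_fin_gen rV)/finPic|/finPic/(ranked_fin_gen rV)].
move=> nKRSA.
have [g [g1 gp]] : exists g, cls_rank f g = 1%N /\ g <> cls1 R.
  apply: contrapT => ng; apply: nKRSA; apply: (KRSA_rank1 (f := f)) => // x x1.
  by apply: contrapT => xp; apply: ng; exists x.
split.
- exact: ranked_half_factorial rV.
- exact: (ranked_catenary_degree rV g1 gp).
- exact: (ranked_tame_degree rV g1 gp).
Qed.
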